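(* Let $G=(V,A)$ be a finite digraph with underlying undirected edge set $E$, and let $x^*\in\mathbb{R}^A$ be a feasible solution to the Held-Karp relaxation for $G$. Define $z^*\in\mathbb{R}_+^E$ by $z^*_{uv}:=x^*_{uv}+x^*_{vu}$. Given a supported $\beta$-thin tree $T$ with respect to $z^*$, a circuit on $G$ in which every vertex is visited at least once and at most $\lceil 4\beta\rceil$ times can be found in polynomial time (in particular, such a circuit exists).
   Context: For a digraph $G=(V,A)$, the underlying undirected edge set is $E$, where $\{u,v\}\in E$ iff $\langle u,v\rangle\in A$ or $\langle v,u\rangle\in A$. For $S\subsetneq V$: $\delta^+(S)=\{\langle u,v\rangle\in A: u\in S, v\notin S\}$, $\delta^-(S)=\delta^+(V\setminus S)$, $\delta(S)=\{e\in E: |e\cap S|=1\}$, and $\delta^{\pm}(v)=\delta^{\pm}(\{v\})$. For a vector $y$ and a set $F$ of its indices, $y(F)=\sum_{f\in F}y_f$. The Held-Karp relaxation for $G$ is the linear system in $x\in\mathbb{R}^A$: $x(\delta^+(v))=x(\delta^-(v))=1$ for all $v\in V$; $x(\delta^+(S))\ge 1$ for all nonempty $S\subsetneq V$; $x\ge 0$. If $\langle u,v\rangle\notin A$, $x^*_{uv}$ is taken to be $0$. A spanning tree $T$ of $(V,E)$ is $\beta$-thin with respect to $z^*$ if $|T\cap\delta(U)|\le\beta z^*(\delta(U))$ for all $U\subsetneq V$; it is a supported $\beta$-thin tree if moreover $z^*_e\ne 0$ for every edge $e$ of $T$. A circuit on $G$ is a closed walk $v_1,\ldots,v_m,v_1$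 along arcs of $G$ (vertices and arcs may be repeated), and the number of times it visits $v$ is the number of $i\in\{1,\dots,m\}$ with $v_i=v$. Numerical data are rational, and polynomial time is with respect to the input size. *)

(* Defs.v *)
From mathcomp Require Export all_boot all_order all_algebra.

Set Implicit Arguments.
Unset Strict Implicit.
Unset Printing Implicit Defensive.

Import Order.TTheory GRing.Theory Num.Theory.

Local Open Scope ring_scope.

Section Digraphs.

Variable V : finType.
Implicit Types (A : {set V * V}) (S U : {set V}) (T : {set {set V}}).

(* A digraph on V is its set of arcs A.  Loops are tolerated in A, but they are
   in no cut and induce no edge. *)

Definition edges A : {set {set V}} :=
  [set [set a.1; a.2] | a in A & a.1 != a.2].

Definition out_cut A S : {set V * V} :=
  [set a in A | (a.1 \in S) && (a.2 \notin S)].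

Definition in_cut A S : {set V * V} := out_cut A (~: S).

Definition cut A S : {set {set V}} :=
  [set e in edges A | #|e :&: S| == 1%N].

Definition vsum (R : nmodType) (I : finType) (y : I -> R) (F : {set I}) : R :=
  \sum_(f in F) y f.

(* A vector of R^A is a function on V * V that vanishes outside A. *)
Definition held_karp (R : numDomainType) A (x : {ffun V * V -> R}) : Prop :=
  [/\ forall a, a \notin A -> x a = 0,
      forall v, vsum x (out_cut A [set v]) = 1 /\
                vsum x (in_cut A [set v]) = 1,
      forall S, S != set0 -> S \proper [set: V] -> 1 <= vsum x (out_cut A S)
    & forall a, a \in A -> 0 <= x a].

(* The sum ranges over the two orientations of the edge e: see zstarE. *)
Definition zstar (R : nmodType) (x : {ffun V * V -> R}) (e : {set V}) : R :=
  \sum_(a : V * V | [set a.1; a.2] == e) x a.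

Lemma zstarE (R : nmodType) (x : {ffun V * V -> R}) (u v : V) :
  u != v -> zstar x [set u; v] = x (u, v) + x (v, u).
Proof.
move=> uv; rewrite /zstar (bigD1 (u, v)) //= (bigD1 (v, u)) /=; last first.
  by rewrite setUC eqxx xpair_eqE negb_and eq_sym uv.
rewrite big1 ?addr0 // => -[a b] /= /andP[/andP[/eqP e ne1] ne2].
have /set2P aE : a \in [set u; v] by rewrite -e set21.
have /set2P bE : b \in [set u; v] by rewrite -e set22.
have /set2P uE : u \in [set a; b] by rewrite e set21.
have /set2P vE : v \in [set a; b] by rewrite e set22.
move: ne1 ne2; rewrite !xpair_eqE.
case: aE uE vE => -> uE vE; case: bE uE vE => -> uE vE; rewrite ?eqxx //.
  by case: vE => vu; rewrite vu eqxx in uv.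
by case: uE => vu; rewrite vu eqxx in uv.
Qed.

Definition adj T : rel V := fun u v => [set u; v] \in T.

(* Connected and acyclic; the empty graph is not a tree. *)
Definition spanning_tree A T : Prop :=
  [/\ (0 < #|V|)%N,
      T \subset edges A,
      forall u v, connect (adj T) u v
    & forall c : seq V, (2 < size c)%N -> ~~ ucycleb (adj T) c].

Definition thin_tree (R : numDomainType) A (z : {set V} -> R) (beta : R) T
  : Prop :=
  spanning_tree A T /\
  forall U, U \proper [set: V] ->
    #|T :&: cut A U|%:R <= beta * vsum z (cut A U).

Definition supported_thin_tree (R : numDomainType) A (z : {set V} -> R)
    (beta : R) T : Prop :=
  thin_tree A z beta T /\ forall e, e \in T -> z e != 0.

(* [:: v_1; ...; v_m] stands for the closed walk v_1, ..., v_m, v_1. *)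
Definition circuit A (c : seq V) : Prop :=
  c <> [::] /\ cycle (fun u v => (u, v) \in A) c.

Definition circuit_visiting A (k : int) (c : seq V) : Prop :=
  circuit A c /\
  forall v, (1 <= count_mem v c)%N /\ (count_mem v c)%:Z <= k.

End Digraphs.

(* Model of computation: the WHILE language of N. D. Jones ("Computability and
   Complexity from a Programming Perspective") over binary trees.  An assignment
   or a test costs the full size of the tree it evaluates to, with no discount
   for sharing, so the total size of the variables of a program never exceeds
   the input size plus the time spent, up to a constant depending on the program.
   Hence polynomial time here is polynomial time on Turing machines, also for
   functions with a large output. *)

Inductive data : Type := Leaf | Node of data & data.

Fixpoint dsize (d : data) : nat :=
  if d is Node d1 d2 then (dsize d1 + dsize d2).+1 else 1%N.

Inductive expr : Type :=
  | Var of nat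
  | ENil
  | ECons of expr & expr
  | EHd of expr
  | ETl of expr.

Inductive cmd : Type :=
  | Assign of nat & expr
  | Seq of cmd & cmd
  | While of expr & cmd.

Definition store : Type := nat -> data.

Definition update (s : store) (i : nat) (d : data) : store :=
  fun j => if j == i then d else s j.

Fixpoint eval (s : store) (e : expr) : data :=
  match e with
  | Var i => s i
  | ENil => Leaf
  | ECons e1 e2 => Node (eval s e1) (eval s e2)
  | EHd e1 => if eval s e1 is Node d _ then d else Leaf
  | ETl e1 => if eval s e1 is Node _ d then d else Leaf
  end.

(* exec c s s' t: from the store s, c halts in the store s' after time t. *)
Inductive exec : cmd -> store -> store -> nat -> Prop :=
  | exec_assign s i e :
      exec (Assign i e) s (update s i (eval s e)) (dsize (eval s e))
  | exec_seq s s1 s2 c1 c2 t1 t2 :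
      exec c1 s s1 t1 -> exec c2 s1 s2 t2 ->
      exec (Seq c1 c2) s s2 (t1 + t2)
  | exec_while_stop s e c :
      eval s e = Leaf -> exec (While e c) s s (dsize (eval s e))
  | exec_while_step s s1 s2 e c t1 t2 :
      eval s e <> Leaf -> exec c s s1 t1 -> exec (While e c) s1 s2 t2 ->
      exec (While e c) s s2 (dsize (eval s e) + t1 + t2).

(* The input is read from, and the output left in, variable 0. *)
Definition computes_within (p : cmd) (input output : data) (bound : nat)
  : Prop :=
  exists (s : store) (t : nat),
    [/\ exec p (update (fun=> Leaf) 0 input) s t, s 0 = output
      & (t <= bound)%N].

Definition enc_bool (b : bool) : data := if b then Node Leaf Leaf else Leaf.

Definition enc_seq (X : Type) (enc : X -> data) (s : seq X) : data :=
  foldr (fun x => Node (enc x)) Leaf s.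

(* Binary digits, least significant first. *)
Definition enc_nat (m : nat) : data :=
  enc_seq enc_bool [seq odd (m %/ 2 ^ i) | i <- iota 0 (up_log 2 m.+1)].

Definition enc_int (z : int) : data := Node (enc_bool (z < 0)) (enc_nat `|z|).

Definition enc_rat (q : rat) : data :=
  Node (enc_int (numq q)) (enc_int (denq q)).

Definition enc_vertex (n : nat) (v : 'I_n) : data := enc_nat v.

Definition enc_vertices (n : nat) (s : seq 'I_n) : data :=
  enc_seq (@enc_vertex n) s.

Definition enc_arc (n : nat) (x : {ffun 'I_n * 'I_n -> rat}) (a : 'I_n * 'I_n)
  : data :=
  Node (Node (enc_vertex a.1) (enc_vertex a.2)) (enc_rat (x a)).

(* Vertices, arcs with their x-values, tree edges with their ends, beta. *)
Definition enc_instance (n : nat) (A : {set 'I_n * 'I_n})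
    (x : {ffun 'I_n * 'I_n -> rat}) (T : {set {set 'I_n}}) (beta : rat)
  : data :=
  Node (enc_vertices (enum 'I_n))
    (Node (enc_seq (enc_arc x) (enum A))
      (Node (enc_seq (fun e : {set 'I_n} => enc_vertices (enum e)) (enum T))
        (enc_rat beta))).

(* Main.v *)
Require Import Defs.
From mathcomp Require Import all_boot all_order all_algebra.
From mathcomp Require Import zify lra.

(* Orient the edges of the tree into a set F of arcs of A.  For an integer K,
   look for a multiset M of arcs of A and of loops such that every vertex has
   out-degree K and in-degree K in F + M: the loops absorb the unused capacity
   of a vertex, so this is a perfect matching problem between K copies of the
   vertices as tails and K copies of the vertices as heads.  A set S of
   tails can be matched with the heads in S and in the set D of its
   out-neighbours.  The arcs of F that enter these from outside S number at most
   |T :&: delta(S)| + \sum_(w in D) |T :&: delta(w)|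
     <= 2 beta x(delta^+(S)) + 2 beta |D| <= 4 beta |D|,
   so Hall's condition holds when 4 beta <= K.  It also holds when K = |F|, by
   strong connectivity.  Removing the loops leaves a balanced connected multiset
   of arcs, and an Eulerian circuit of it is the circuit looked for.  The
   algorithm ignores x and beta: it takes the first K for which augmenting
   paths find a perfect matching. *)

Set Implicit Arguments.
Unset Strict Implicit.
Unset Printing Implicit Defensive.

(** * Polynomial-time functions *)

(** The only WHILE programs written out are assignments, composition, pairing, case distinction and
    one fold; the algorithm is a function on lists, and its running time follows from closure
    properties. This shapes the algorithm: every loop is a fold over a list already at hand, which
    serves as its clock, and a round only moves data or adds a bounded amount.

    Reading neither [x] nor [beta] avoids rational arithmetic, and stopping the search for K at |F|
    keeps it polynomial even when [beta] is exponentially large.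

    The vertices of the algorithm form an arbitrary [eqType], so that one correctness proof, along
    an injection of the vertices, serves both the abstract statement and the run on binary
    numbers. *)

Structure encT := EncT {esort :> Type; enc : esort -> data}.
Arguments enc {_} _.

Canonical data_encT := EncT (fun d : data => d).
Canonical nat_encT := EncT enc_nat.
Canonical bool_encT := EncT enc_bool.
Canonical prod_encT (X Y : encT) :=
  EncT (fun p : X * Y => Node (enc p.1) (enc p.2)).
Canonical seq_encT (X : encT) := EncT (enc_seq (@enc X)).

Lemma dsize_gt0 d : 0 < dsize d.
Proof. by case: d. Qed.

Lemma dsize_seq (X : encT) (s : seq X) :
  dsize (enc s) = (\sum_(x <- s) (dsize (enc x)).+1).+1.
Proof.
elim: s => [|x s IH]; first by rewrite big_nil.
rewrite big_cons -[dsize _]/(dsize (enc x) + dsize (enc s)).+1 IH.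
by rewrite addSn addnS.
Qed.

Lemma dsize_pair (X Y : encT) (x : X) (y : Y) :
  dsize (enc (x, y)) = (dsize (enc x) + dsize (enc y)).+1.
Proof. by []. Qed.

Lemma dsize_cons (X : encT) (x : X) (s : seq X) :
  dsize (enc (x :: s)) = (dsize (enc x) + dsize (enc s)).+1.
Proof. by []. Qed.

Lemma size_dsize (X : encT) (s : seq X) : size s < dsize (enc s).
Proof.
elim: s => [|x s IH] //; rewrite dsize_cons -[size _]/(size s).+1.
have := dsize_gt0 (enc x); lia.
Qed.

Lemma dsize_drop (X : encT) (s : seq X) i :
  dsize (enc (drop i s)) <= dsize (enc s).
Proof.
elim: s i => [|x s IH] [|i] //; apply: leq_trans (IH i) _.
by rewrite dsize_cons; lia.
Qed.

(** A single monomial suffices, without a constant term, because every tree has size at least 1. *)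
Definition polyb (X : encT) (h : X -> nat) :=
  exists a k, forall x, h x <= a * dsize (enc x) ^ k.

Section Polyb.
Variable X : encT.
Implicit Types h : X -> nat.

Lemma polyb_le h h' : (forall x, h x <= h' x) -> polyb h' -> polyb h.
Proof. by move=> le [a [k b]]; exists a, k => x; apply: leq_trans (b x). Qed.

Lemma polyb_const c : polyb (fun _ : X => c).
Proof. by exists c, 0 => x; rewrite expn0 muln1. Qed.

Lemma polyb_dsize : polyb (fun x : X => dsize (enc x)).
Proof. by exists 1, 1 => x; rewrite expn1 mul1n. Qed.

Lemma polybM h h' : polyb h -> polyb h' -> polyb (fun x => h x * h' x).
Proof.
move=> [a [k b]] [a' [k' b']]; exists (a * a'), (k + k') => x.
by rewrite expnD mulnACA leq_mul.
Qed.

Lemma polybD h h' : polyb h -> polyb h' -> polyb (fun x => h x + h' x).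
Proof.
move=> [a [k b]] [a' [k' b']]; exists (a + a'), (k + k') => x.
have d0 := dsize_gt0 (enc x).
rewrite mulnDl leq_add //.
  by apply: leq_trans (b x) _; rewrite leq_mul // leq_pexp2l // leq_addr.
by apply: leq_trans (b' x) _; rewrite leq_mul // leq_pexp2l // leq_addl.
Qed.

Lemma polybX h k : polyb h -> polyb (fun x => h x ^ k).
Proof.
move=> ph; elim: k => [|k IH]; first exact: polyb_const.
by apply: polyb_le (polybM ph IH) => x; rewrite expnS.
Qed.
End Polyb.

Lemma polyb_comp (X Y : encT) (f : X -> Y) (h : Y -> nat) (g : X -> nat) :
  polyb h -> polyb g -> (forall x, dsize (enc (f x)) <= g x) ->
  polyb (fun x => h (f x)).
Proof.
move=> [a [k b]] pg le.
apply: (polyb_le (h' := fun x => a * g x ^ k)) => [x|].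
  by apply: leq_trans (b _) _; rewrite leq_mul //; case: (k) => // j;
    rewrite leq_exp2r.
by apply: polybM; [apply: polyb_const|apply: polybX].
Qed.

Ltac polyb_tac := repeat first
  [ assumption | exact: polyb_const | exact: polyb_dsize
  | lazymatch goal with
    | |- polyb (fun _ => _ + _) => apply: polybD
    | |- polyb (fun _ => _ * _) => apply: polybM
    | |- polyb (fun _ => _ ^ _) => apply: polybX
    end ].

(** * Total correctness of programs with running times *)

Definition runs p s (Q : store -> nat -> Prop) :=
  exists s' t, exec p s s' t /\ Q s' t.

Lemma runs_assign s i e (Q : store -> nat -> Prop) :
  Q (update s i (eval s e)) (dsize (eval s e)) -> runs (Assign i e) s Q.
Proof. by move=> q; do 2!eexists; split; first exact: exec_assign. Qed.

Lemma runs_seq p q s (Q : store -> nat -> Prop) :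
  runs p s (fun s1 t1 => runs q s1 (fun s2 t2 => Q s2 (t1 + t2))) ->
  runs (Seq p q) s Q.
Proof.
move=> [s1 [t1 [e1 [s2 [t2 [e2 q2]]]]]].
by exists s2, (t1 + t2); split=> //; apply: exec_seq e1 e2.
Qed.

Lemma runs_stop e c s (Q : store -> nat -> Prop) :
  eval s e = Leaf -> Q s 1 -> runs (While e c) s Q.
Proof.
by move=> e0 q; exists s, 1; split=> //; rewrite -[1]/(dsize Leaf) -e0;
   apply: exec_while_stop.
Qed.

Lemma runs_step e c s (Q : store -> nat -> Prop) :
  eval s e <> Leaf ->
  runs c s (fun s1 t1 => runs (While e c) s1
    (fun s2 t2 => Q s2 (dsize (eval s e) + t1 + t2))) ->
  runs (While e c) s Q.
Proof.
move=> e0 [s1 [t1 [e1 [s2 [t2 [e2 q2]]]]]].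
by exists s2, (dsize (eval s e) + t1 + t2); split=> //;
   apply: exec_while_step e1 e2.
Qed.

Lemma runs_conseq p s (Q Q' : store -> nat -> Prop) :
  runs p s Q -> (forall s' t, Q s' t -> Q' s' t) -> runs p s Q'.
Proof. by move=> [s' [t [e q]]] sub; exists s', t; split=> //; apply: sub. Qed.

(* The variables from m on are preserved: a program that calls p keeps its own
   data there. *)
Definition computes (X Y : encT) p m (h : X -> nat) (f : X -> Y) :=
  forall x s, s 0 = enc x -> runs p s (fun s' t =>
    [/\ s' 0 = enc (f x), forall i, m <= i -> s' i = s i & t <= h x]).

Definition ptime (X Y : encT) (f : X -> Y) :=
  exists p m h, polyb h /\ computes p m h f.

Lemma ptime_ext (X Y : encT) (f g : X -> Y) : ptime f -> f =1 g -> ptime g.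
Proof.
move=> [p [m [h [bh cp]]]] fg; exists p, m, h; split=> // x s /cp.
by rewrite fg.
Qed.

Lemma exec_dsize p s s' t : exec p s s' t ->
  forall i, dsize (s' i) <= dsize (s i) + t.
Proof.
elim=> {p s s' t} [s j e|s s1 s2 c1 c2 t1 t2 _ IH1 _ IH2|s e c _|
    s s1 s2 e c t1 t2 _ _ IH1 _ IH2] i.
- by rewrite /update; case: eqP => _; rewrite (leq_addl, leq_addr).
- have := IH1 i; have := IH2 i; lia.
- by rewrite leq_addr.
- have := IH1 i; have := IH2 i; lia.
Qed.

(** Writing a tree costs its full size, so the running time already bounds the output. Composition
    therefore needs no separate hypothesis on sizes. *)
Lemma ptime_dsize (X Y : encT) (f : X -> Y) :
  ptime f -> polyb (fun x => dsize (enc (f x))).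
Proof.
move=> [p [m [h [ph cp]]]].
apply: (polyb_le (h' := fun x => dsize (enc x) + h x)) => [x|]; last first.
  by apply: polybD => //; apply: polyb_dsize.
have [s' [t [/exec_dsize/(_ 0) + [<- _ le]]]] :=
  cp x (update (fun=> Leaf) 0 (enc x)) erefl.
by rewrite /update /= => d; apply: leq_trans d _; rewrite leq_add2l.
Qed.

Lemma ptime_expr (X Y : encT) (f : X -> Y) e :
  (forall x s, s 0 = enc x -> eval s e = enc (f x)) ->
  polyb (fun x => dsize (enc (f x))) -> ptime f.
Proof.
move=> ev pf; exists (Assign 0 e), 1.
exists (fun x => dsize (enc (f x))); split=> // x s s0.
by apply: runs_assign; rewrite (ev x s s0); split=> // -[|i].
Qed.

Lemma ptime_comp (X Y Z : encT) (g : Y -> Z) (f : X -> Y) :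
  ptime g -> ptime f -> ptime (fun x => g (f x)).
Proof.
move=> pg pf; have df := ptime_dsize pf.
move: pg => [pg [mg [hg [bg cg]]]].
move: pf => [pf [mf [hf [bf cf]]]].
exists (Seq pf pg), (maxn mf mg), (fun x => hf x + hg (f x)).
split; first by apply: polybD => //; apply: polyb_comp bg df _.
move=> x s s0; apply: runs_seq.
apply: runs_conseq (cf x s s0) _ => s1 t1 [s10 fr1 le1].
apply: runs_conseq (cg _ s1 s10) _ => s2 t2 [s20 fr2 le2].
split=> // [i|]; last by rewrite leq_add.
by rewrite geq_max => /andP[mi gi]; rewrite fr2 // fr1.
Qed.

Ltac simpl_update := rewrite /update; repeat (case: eqP => ?; try lia);
  try done; try lia.

Lemma ptime_pair (X Y Z : encT) (f : X -> Y) (g : X -> Z) :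
  ptime f -> ptime g -> ptime (fun x => (f x, g x)).
Proof.
move=> pf pg; have df := ptime_dsize pf; have dg := ptime_dsize pg.
move: pg => [pg [mg [hg [bg cg]]]].
move: pf => [pf [mf [hf [bf cf]]]].
(* Neither subprogram changes the variables from [m] on: [m] keeps the input and [m.+1] the first
   result. The successor keeps [m] distinct from variable 0. *)
pose m := (maxn mf mg).+1.
exists (Seq (Assign m (Var 0)) (Seq pf (Seq (Assign m.+1 (Var 0))
  (Seq (Assign 0 (Var m)) (Seq pg (Assign 0 (ECons (Var m.+1) (Var 0)))))))).
exists m.+2, (fun x => dsize (enc x) + (hf x + (dsize (enc (f x)) +
  (dsize (enc x) + (hg x + dsize (enc (f x, g x))))))).
split.
  polyb_tac; apply: (polyb_le (h' := fun x =>
    1 + (dsize (enc (f x)) + dsize (enc (g x))))) => //.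
  by polyb_tac.
move=> x s s0; apply: runs_seq; apply: runs_assign; apply: runs_seq.
apply: runs_conseq (cf x _ _) _ => [|s1 t1 [s10 fr1 le1]];
  first by simpl_update.
apply: runs_seq; apply: runs_assign; apply: runs_seq; apply: runs_assign.
apply: runs_seq.
have s1m : s1 m = enc x by rewrite fr1 /=; simpl_update.
apply: runs_conseq (cg x _ _) _ => [|s2 t2 [s20 fr2 le2]].
  by rewrite /=; simpl_update.
have u1 : s2 m.+1 = enc (f x) by rewrite fr2 /=; simpl_update.
apply: runs_assign; rewrite /= s20 u1; split.
- by simpl_update.
- by move=> i mi; simpl_update; rewrite fr2; simpl_update; rewrite fr1;
  simpl_update.
- have -> : update s1 m.+1 (s1 0) m = enc x by simpl_update.
  by rewrite s0 s10; lia.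
Qed.

(** The language has no conditional; two loops, each run at most once, simulate it. The first is
    guarded by the list and clears the flag [m.+2] that guards the second. *)
Lemma ptime_case (X Y Z : encT) (l : X -> seq Y) (f : X * (Y * seq Y) -> Z)
    (g : X -> Z) :
  ptime l -> ptime f -> ptime g ->
  ptime (fun x => if l x is y :: s then f (x, (y, s)) else g x).
Proof.
move=> pl pf pg; have dl := ptime_dsize pl.
move: pg => [pg [mg [hg [bg cg]]]].
move: pf => [pf [mf [hf [bf cf]]]].
move: pl => [pl [ml [hl [bl cl]]]].
pose m := (maxn ml (maxn mf mg)).+1.
exists (Seq (Assign m (Var 0)) (Seq pl (Seq (Assign m.+1 (Var 0))
  (Seq (Assign m.+2 (ECons ENil ENil)) (Seq (Assign 0 (Var m))
  (Seq
    (While (Var m.+1) (Seq (Assign 0 (ECons (Var m) (Var m.+1)))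
      (Seq pf (Seq (Assign m.+1 ENil) (Assign m.+2 ENil)))))
    (While (Var m.+2) (Seq pg (Assign m.+2 ENil))))))))).
exists m.+3.
pose hf' x := if l x is y :: s then hf (x, (y, s)) else 0.
exists (fun x => 3 * dsize (enc x) + hl x + 3 * dsize (enc (l x))
  + hf' x + hg x + 20).
split.
  have bd := @polyb_dsize X.
  polyb_tac; case: bf => a [k b].
    apply: (polyb_le (h' := fun x =>
      a * (1 + (dsize (enc x) + dsize (enc (l x)))) ^ k)).
      by rewrite /hf' => x; case: (l x) => // y s; apply: b.
    by polyb_tac.
move=> x s s0; rewrite /hf'.
apply: runs_seq; apply: runs_assign; apply: runs_seq.
apply: runs_conseq (cl x _ _) _ => [|s1 t1 [s10 fr1 le1]];
  first by simpl_update.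
have s1m : s1 m = enc x by rewrite fr1 /=; simpl_update.
do 3![apply: runs_seq; apply: runs_assign].
set s2 := update _ 0 _.
have s20 : s2 0 = enc x by rewrite /s2 /=; simpl_update.
have s2m : s2 m = enc x by rewrite /s2 /=; simpl_update.
have s2m1 : s2 m.+1 = enc (l x) by rewrite /s2 /= -s10; simpl_update.
have s2m2 : s2 m.+2 = Node Leaf Leaf by rewrite /s2 /=; simpl_update.
have s2i i : m.+2 < i -> s2 i = s i.
  by move=> mi; rewrite /s2 /=; simpl_update; rewrite fr1; simpl_update.
rewrite /= s10 s0.
have -> : update (update s1 m.+1 (enc (l x))) m.+2 (Node Leaf Leaf) m = enc x.
  by simpl_update.
move: s2 s20 s2m s2m1 s2m2 s2i => s2 s20 s2m s2m1 s2m2 s2i.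
apply: runs_seq; case lx: (l x) => [|y r].
  apply: runs_stop; first by rewrite /= s2m1 lx.
  apply: runs_step; first by rewrite /= s2m2.
  apply: runs_seq.
  apply: runs_conseq (cg x _ s20) _ => s3 t3 [s30 fr3 le3].
  apply: runs_assign; apply: runs_stop; first by rewrite /=; simpl_update.
  split; first by simpl_update.
    by move=> i mi; simpl_update; rewrite fr3; [exact: s2i|lia].
  by rewrite /= s2m2 /=; lia.
apply: runs_step; first by rewrite /= s2m1 lx.
apply: runs_seq; apply: runs_assign; apply: runs_seq.
apply: runs_conseq (cf (x, (y, r)) _ _) _ => [|s3 t3 [s30 fr3 le3]].
  by rewrite /= s2m s2m1 lx; simpl_update.
apply: runs_seq; do 2!apply: runs_assign.
apply: runs_stop; first by rewrite /=; simpl_update.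
apply: runs_stop; first by rewrite /=; simpl_update.
split; first by simpl_update.
  by move=> i mi; simpl_update; rewrite fr3 /=; simpl_update; rewrite s2i;
    simpl_update.
rewrite /= s2m s2m1 lx /=; move: le3; set E := hf _.
move: (dsize (enc y)) (dsize (enc x)) (dsize (enc_seq _ _)) => *; lia.
Qed.

(** The bound [h] on the accumulator after every prefix of the list makes each call of [g]
    polynomial in the size of [x], and the number of calls is at most the size of the list. *)
Lemma ptime_foldl (X Y Z : encT) (g : X -> Z -> Y -> Z) (z : X -> Z)
    (l : X -> seq Y) (h : X -> nat) :
  ptime (fun p : X * Z * Y => g p.1.1 p.1.2 p.2) -> ptime z -> ptime l ->
  polyb h ->
  (forall x i, dsize (enc (foldl (g x) (z x) (take i (l x)))) <= h x) ->
  ptime (fun x => foldl (g x) (z x) (l x)).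
Proof.
move=> pg pz pl bh le_h; have dl := ptime_dsize pl; have dz := ptime_dsize pz.
move: pg => [pg [mg [hg [[a [k bg]] cg]]]].
move: pz => [pz [mz [hz [bz cz]]]].
move: pl => [pl [ml [hl [bl cl]]]].
pose m := (maxn ml (maxn mz mg)).+1.
pose W := While (Var m.+2)
  (Seq (Assign 0 (ECons (ECons (Var m) (Var m.+1)) (EHd (Var m.+2))))
  (Seq pg (Seq (Assign m.+1 (Var 0)) (Assign m.+2 (ETl (Var m.+2)))))).
exists (Seq (Assign m (Var 0)) (Seq pz (Seq (Assign m.+1 (Var 0))
  (Seq (Assign 0 (Var m)) (Seq pl (Seq (Assign m.+2 (Var 0))
  (Seq W (Assign 0 (Var m.+1))))))))).
(* [sz] bounds the argument passed to [g]. [C] bounds one round: the guard, building the argument,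
   the call, storing the result, taking the tail. *)
pose sz x := 2 + dsize (enc x) + h x + dsize (enc (l x)).
pose C x := dsize (enc (l x)) + sz x + a * sz x ^ k + h x + dsize (enc (l x)).
exists m.+3, (fun x => dsize (enc x) + hz x + h x + dsize (enc x) + hl x
  + dsize (enc (l x)) + (dsize (enc (l x)) * C x + 1) + h x).
split; first by rewrite /C /sz; polyb_tac.
have loop x r l1 s : l x = l1 ++ r -> s m = enc x ->
    s m.+1 = enc (foldl (g x) (z x) l1) -> s m.+2 = enc r ->
    runs W s (fun s' t => [/\ s' m.+1 = enc (foldl (g x) (z x) (l x)),
      forall i, m.+2 < i -> s' i = s i & t <= size r * C x + 1]).
  elim: r l1 s => [|y r IH] l1 s lx sm sm1 sm2.
    by apply: runs_stop => //; split=> //; rewrite sm1 lx cats0.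
  apply: runs_step; first by rewrite /= sm2.
  apply: runs_seq; apply: runs_assign; apply: runs_seq.
  pose zc := foldl (g x) (z x) l1.
  apply: runs_conseq (cg (x, zc, y) _ _) _ => [|s1 t1 [s10 fr1 le1]].
    by rewrite /= sm sm1 sm2; simpl_update.
  have s1m : s1 m = enc x by rewrite fr1 /=; simpl_update.
  have s1m1 : s1 m.+1 = enc zc by rewrite fr1 /=; simpl_update.
  have s1m2 : s1 m.+2 = enc (y :: r) by rewrite fr1 /=; simpl_update.
  apply: runs_seq; do 2!apply: runs_assign.
  rewrite -cat_rcons in lx.
  have := IH (rcons l1 y) _ lx; rewrite foldl_rcons -/zc /= => {}IH.
  have -> : update s1 m.+1 (s1 0) m.+2 = enc (y :: r) by rewrite -s1m2;
    simpl_update.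
  apply: runs_conseq (IH _ _ _ _) _ => [|||s2 t2 [q1 q2 q3]];
    do ?[by simpl_update].
  split=> // [i mi|].
    by rewrite q2 //; simpl_update; rewrite fr1 /=; simpl_update.
  have d1 : dsize (enc zc) <= h x.
    by have := le_h x (size l1); rewrite lx cat_rcons take_size_cat.
  have d2 : dsize (enc (g x zc y)) <= h x.
    have := le_h x (size (rcons l1 y)); rewrite lx take_size_cat //.
    by rewrite foldl_rcons.
  have d3 : dsize (enc (y :: r)) <= dsize (enc (l x)).
    by have := dsize_drop (l x) (size l1); rewrite lx cat_rcons drop_size_cat.
  have d4 : t1 <= a * sz x ^ k.
    apply: leq_trans le1 _; apply: leq_trans (bg _) _.
    rewrite leq_mul //; case: (k) => // j; rewrite leq_exp2r //.
    by rewrite /sz !dsize_pair; move: d3; rewrite dsize_cons; lia.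
  have d5 : dsize (enc y) + dsize (enc r) < dsize (enc (l x)).
    by move: d3; rewrite dsize_cons.
  rewrite sm sm1 sm2 s10 mulSn.
  have Cx : C x = dsize (enc (l x)) + (2 + dsize (enc x) + h x + dsize (enc (l
    x)))
    + a * sz x ^ k + h x + dsize (enc (l x)) by [].
  have -> : dsize (if enc (y :: r) is Node _ d then d else Leaf) = dsize (enc
    r) by [].
  have -> : dsize (if enc (y :: r) is Node d _ then d else Leaf) = dsize (enc
    y) by [].
  rewrite -[g _.1.1 _ _]/(g x zc y) -/zc; lia.
move=> x s s0; apply: runs_seq; apply: runs_assign; apply: runs_seq.
apply: runs_conseq (cz x _ _) _ => [|s1 t1 [s10 fr1 le1]];
  first by simpl_update.
have s1m : s1 m = enc x by rewrite fr1 /=; simpl_update.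
do 2![apply: runs_seq; apply: runs_assign]; apply: runs_seq.
apply: runs_conseq (cl x _ _) _ => [|s2 t2 [s20 fr2 le2]].
  by rewrite /=; simpl_update.
have s2m : s2 m = enc x by rewrite fr2 /=; simpl_update.
have s2m1 : s2 m.+1 = enc (z x) by rewrite fr2 /= -?s10; simpl_update.
apply: runs_seq; apply: runs_assign; apply: runs_seq.
apply: runs_conseq (loop x (l x) [::] _ erefl _ _ _) _ => [|||s3 t3 [q1 q2 q3]].
- by simpl_update.
- by simpl_update.
- by rewrite /= s20; simpl_update.
apply: runs_assign; rewrite /= q1 s20 s10 s0; split.
- by simpl_update.
- by move=> i mi; simpl_update; rewrite q2 //; simpl_update; rewrite fr2 /=;
  simpl_update; rewrite fr1 /=; simpl_update.
- have -> : update s1 m.+1 (enc (z x)) m = enc x by simpl_update.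
  have d1 : dsize (enc (z x)) <= h x by have := le_h x 0; rewrite take0.
  have d2 : dsize (enc (foldl (g x) (z x) (l x))) <= h x.
    by have := le_h x (size (l x)); rewrite take_size.
  have d3 : size (l x) * C x <= dsize (enc (l x)) * C x.
    by rewrite leq_mul // ltnW // size_dsize.
  change (enc_seq enc (l x)) with (enc (l x)); lia.
Qed.

(** * Polynomial-time operations on pairs, booleans and lists *)

Fixpoint quote (d : data) : expr :=
  if d is Node d1 d2 then ECons (quote d1) (quote d2) else ENil.

Lemma eval_quote s d : eval s (quote d) = d.
Proof. by elim: d => //= d1 -> d2 ->. Qed.

Lemma ptime_id (X : encT) : ptime (fun x : X => x).
Proof. exact: (ptime_expr (e := Var 0) (fun _ _ => id) (@polyb_dsize X)). Qed.

Lemma ptime_const (X Y : encT) (y : Y) : ptime (fun _ : X => y).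
Proof.
apply: (ptime_expr (e := quote (enc y))); last exact: polyb_const.
by move=> x s _; rewrite eval_quote.
Qed.

(** A function that leaves the encoding unchanged is a mere change of type: a pair becomes a list
    cell, a boolean a list with at most one entry, a number its list of bits. *)
Lemma ptime_recode (X Y Z : encT) (g : X -> Y) (f : Y -> Z) :
  ptime g -> (forall y, enc (f y) = enc y) -> ptime (fun x => f (g x)).
Proof.
move=> pg e; apply: ptime_comp pg; apply: (ptime_expr (e := Var 0)).
  by move=> y s; rewrite e.
by apply: (polyb_le (h' := fun y => dsize (enc y))) => [y|];
  [rewrite e|polyb_tac].
Qed.

Lemma ptime_fst (X Y Z : encT) (f : X -> Y * Z) :
  ptime f -> ptime (fun x => (f x).1).
Proof.
apply: ptime_comp; apply: (ptime_expr (e := EHd (Var 0))).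
  by move=> [y z] s /= ->.
by apply: (polyb_le (h' := fun y => dsize (enc y))) => [[y z]|];
  [rewrite dsize_pair /=; lia|polyb_tac].
Qed.

Lemma ptime_snd (X Y Z : encT) (f : X -> Y * Z) :
  ptime f -> ptime (fun x => (f x).2).
Proof.
apply: ptime_comp; apply: (ptime_expr (e := ETl (Var 0))).
  by move=> [y z] s /= ->.
by apply: (polyb_le (h' := fun y => dsize (enc y))) => [[y z]|];
  [rewrite dsize_pair /=; lia|polyb_tac].
Qed.

Lemma ptime_cons (X Y : encT) (f : X -> Y) (g : X -> seq Y) :
  ptime f -> ptime g -> ptime (fun x => f x :: g x).
Proof.
by move=> pf pg; apply: (ptime_recode (f := fun p =>
  p.1 :: p.2) (ptime_pair pf pg)).
Qed.

Lemma ptime_match (X Y Z : encT) (l : X -> seq Y) (f : X -> Y -> seq Y -> Z)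
    (g : X -> Z) :
  ptime l -> ptime (fun p : X * (Y * seq Y) => f p.1 p.2.1 p.2.2) -> ptime g ->
  ptime (fun x => if l x is y :: s then f x y s else g x).
Proof. exact: ptime_case. Qed.

Lemma ptime_if (X Y : encT) (b : X -> bool) (f g : X -> Y) :
  ptime b -> ptime f -> ptime g -> ptime (fun x => if b x then f x else g x).
Proof.
move=> pb pf pg.
have pl : ptime (fun x => if b x then [:: Leaf] else [::]).
  by apply: (ptime_recode (f := fun b => if b then [:: Leaf] else [::]) pb);
    case.
have pf' : ptime (fun p : X * (data * seq data) => f p.1).
  exact: ptime_comp pf (ptime_fst (ptime_id _)).
apply: (ptime_ext (ptime_match (f := fun x _ _ => f x) pl pf' pg)) => x.
by case: (b x).
Qed.

Lemma ptime_andb (X : encT) (b c : X -> bool) :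
  ptime b -> ptime c -> ptime (fun x => b x && c x).
Proof. by move=> pb pc; apply: (ptime_if pb pc); apply: ptime_const. Qed.

Lemma ptime_orb (X : encT) (b c : X -> bool) :
  ptime b -> ptime c -> ptime (fun x => b x || c x).
Proof. by move=> pb pc; apply: (ptime_if pb _ pc); apply: ptime_const. Qed.

Lemma ptime_negb (X : encT) (b : X -> bool) :
  ptime b -> ptime (fun x => ~~ b x).
Proof. by move=> pb; apply: (ptime_if pb); apply: ptime_const. Qed.

Lemma ptime_nilp (X Y : encT) (l : X -> seq Y) :
  ptime l -> ptime (fun x => nilp (l x)).
Proof.
move=> pl; apply: (ptime_ext (ptime_match (f := fun _ _ _ => false)
  (g := fun=> true) pl (ptime_const _ _) (ptime_const _ _))) => x.
by case: (l x).
Qed.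

(** The increment [h x] is independent of the accumulator, so the size after any number of rounds is
    at most the initial size plus one increment per entry of the list. *)
Lemma ptime_foldl_grow (X Y Z : encT) (g : X -> Z -> Y -> Z) (z : X -> Z)
    (l : X -> seq Y) (h : X -> nat) :
  ptime (fun p : X * Z * Y => g p.1.1 p.1.2 p.2) -> ptime z -> ptime l ->
  polyb h ->
  (forall x z' y, dsize (enc y) <= dsize (enc (l x)) ->
    dsize (enc (g x z' y)) <= dsize (enc z') + h x) ->
  ptime (fun x => foldl (g x) (z x) (l x)).
Proof.
move=> pg pz pl bh grow.
have bz := ptime_dsize pz; have bl := ptime_dsize pl.
pose h' x := dsize (enc (z x)) + dsize (enc (l x)) * h x.
apply: (ptime_foldl (h := h')) => //; first by rewrite /h'; polyb_tac.
move=> x i; apply: (@leq_trans (dsize (enc (z x)) + size (take i (l x)) * h x)).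
  elim: i => [|i IH]; first by rewrite take0 leq_addr.
  have [sz|sz] := leqP (size (l x)) i.
    by rewrite take_oversize ?(leqW sz) //; rewrite take_oversize // in IH.
  case lx : (l x) => [|y0 l0]; first by rewrite lx in sz.
  have dy : dsize (enc (nth y0 (l x) i)) <= dsize (enc (l x)).
    by apply: leq_trans (dsize_drop _ i); rewrite (drop_nth y0) // dsize_cons;
      lia.
  rewrite -lx (take_nth y0) // foldl_rcons.
  by apply: leq_trans (grow _ _ _ dy) _; rewrite size_rcons mulSn; lia.
rewrite leq_add2l leq_mul //; apply: leq_trans (ltnW (size_dsize _)).
by rewrite size_take_min geq_minr.
Qed.

Lemma ptime_catrev (X Y : encT) (f g : X -> seq Y) :
  ptime f -> ptime g -> ptime (fun x => catrev (f x) (g x)).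
Proof.
move=> pf pg; have bf := ptime_dsize pf.
have catrevE (s t : seq Y) : foldl (fun s y => y :: s) t s = catrev s t.
  by elim: s t => //= y s IH t; rewrite IH.
apply: (ptime_ext (f := fun x => foldl (fun s y => y :: s) (g x) (f x))).
  apply: (@ptime_foldl_grow X Y _ (fun _ s y => y :: s) g f
    (fun x => (dsize (enc (f x))).+1)) => //.
  - by apply: ptime_cons; [apply: ptime_snd|apply/ptime_snd/ptime_fst];
      apply: ptime_id.
  - apply: (polyb_le (h' := fun x => dsize (enc (f x)) + 1)) => [x|]; first lia.
    by polyb_tac.
  - by move=> x z y; rewrite dsize_cons; lia.
by move=> x; rewrite catrevE.
Qed.

Lemma ptime_rev (X Y : encT) (f : X -> seq Y) :
  ptime f -> ptime (fun x => rev (f x)).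
Proof. by move=> pf; apply: ptime_catrev => //; apply: ptime_const. Qed.

Lemma ptime_cat (X Y : encT) (f g : X -> seq Y) :
  ptime f -> ptime g -> ptime (fun x => f x ++ g x).
Proof.
move=> pf pg; apply: ptime_ext (ptime_catrev (ptime_rev pf) pg) _ => x.
by rewrite catrevE revK.
Qed.

Lemma dsize_catrev (X : encT) (s t : seq X) :
  dsize (enc (catrev s t)) < dsize (enc s) + dsize (enc t).
Proof.
elim: s t => [|x s IH] t; first by rewrite /= add1n ltnS.
by apply: leq_trans (IH _) _; rewrite !dsize_cons; lia.
Qed.

Lemma ptime_flatten (X Y : encT) (f : X -> seq (seq Y)) :
  ptime f -> ptime (fun x => flatten (f x)).
Proof.
move=> pf; have bf := ptime_dsize pf.
apply: (ptime_ext (ptime_rev (@ptime_foldl_grow X _ _ (fun _ s y => catrev y s)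
  (fun=> [::]) f (fun x => (dsize (enc (f x))).+1) _ _ _ _ _))) => //.
- by apply: ptime_catrev; [apply: ptime_snd|apply/ptime_snd/ptime_fst];
  apply: ptime_id.
- exact: ptime_const.
- by apply: (polyb_le (h' := fun x => dsize (enc (f x)) + 1)) => [x|];
  [lia|polyb_tac].
- by move=> x z y; have := dsize_catrev y z; lia.
have acc (s : seq (seq Y)) a :
    rev (foldl (fun s y => catrev y s) a s) = rev a ++ flatten s.
  by elim: s a => [|y s IH] a /=;
    rewrite ?cats0 // IH catrevE rev_cat revK catA.
by move=> x; rewrite acc.
Qed.

Lemma ptime_map (X Y Z : encT) (f : X -> Y -> Z) (l : X -> seq Y) :
  ptime (fun p : X * Y => f p.1 p.2) -> ptime l ->
  ptime (fun x => [seq f x y | y <- l x]).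
Proof.
move=> pf pl; have bl := ptime_dsize pl; have [a [k bf]] := ptime_dsize pf.
pose h x := 1 + a * (1 + dsize (enc x) + dsize (enc (l x))) ^ k.
apply: (ptime_ext (ptime_rev (@ptime_foldl_grow X _ _ (fun x s y => f x y :: s)
  (fun=> [::]) l h _ _ _ _ _))) => //.
- apply: ptime_cons.
    apply: (ptime_comp (f := fun p : X * seq Z * Y => (p.1.1, p.2)) pf).
    by apply: ptime_pair; [apply/ptime_fst/ptime_fst|apply/ptime_snd];
      apply: ptime_id.
  by apply/ptime_snd/ptime_fst/ptime_id.
- exact: ptime_const.
- by rewrite /h; polyb_tac.
- move=> x z y le; rewrite dsize_cons /h.
  have le2 : dsize (enc (f x y)) <= a * (1 + dsize (enc x) + dsize (enc (l x)))
    ^ k.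
    apply: leq_trans (bf (x, y)) _; rewrite leq_mul //; case: (k) => // j.
    by rewrite leq_exp2r // dsize_pair; lia.
  by move: le2; move: (a * _) => *; lia.
have acc x (s : seq Y) b :
    rev (foldl (fun s y => f x y :: s) b s) = rev b ++ [seq f x y | y <- s].
  by elim: s b => [|y s IH] b /=; rewrite ?cats0 // IH rev_cons cat_rcons.
by move=> x; rewrite acc.
Qed.

Lemma ptime_filter (X Y : encT) (b : X -> Y -> bool) (l : X -> seq Y) :
  ptime (fun p : X * Y => b p.1 p.2) -> ptime l ->
  ptime (fun x => [seq y <- l x | b x y]).
Proof.
move=> pb pl.
apply: (ptime_ext (f := fun x =>
  flatten [seq if b x y then [:: y] else [::] | y <- l x])).
  apply/ptime_flatten/ptime_map => //; apply: ptime_if => //;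
    last exact: ptime_const.
  by apply: ptime_cons; [apply/ptime_snd/ptime_id|apply: ptime_const].
by move=> x; elim: (l x) => //= y s ->; case: (b x y).
Qed.

Lemma ptime_has (X Y : encT) (b : X -> Y -> bool) (l : X -> seq Y) :
  ptime (fun p : X * Y => b p.1 p.2) -> ptime l ->
  ptime (fun x => has (b x) (l x)).
Proof.
move=> pb pl; apply: (ptime_ext (ptime_negb (ptime_nilp (ptime_filter pb pl)))).
by move=> x; rewrite /nilp size_filter has_count lt0n.
Qed.

Ltac solve_ptime_hook := fail.
Ltac solve_ptime := repeat first
  [ assumption
  | lazymatch goal with
    | |- ptime (fun x => x) => exact: ptime_id
    | |- ptime fst => exact: (ptime_fst (ptime_id _))
    | |- ptime snd => exact: (ptime_snd (ptime_id _))
    | |- ptime (fun _ => ?c) => exact: ptime_const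
    | |- ptime (fun _ => fst _) => apply: ptime_fst
    | |- ptime (fun _ => snd _) => apply: ptime_snd
    | |- ptime (fun _ => (_, _)) => apply: ptime_pair
    | |- ptime (fun _ => _ :: _) => apply: ptime_cons
    | |- ptime (fun _ => _ && _) => apply: ptime_andb
    | |- ptime (fun _ => _ || _) => apply: ptime_orb
    | |- ptime (fun _ => ~~ _) => apply: ptime_negb
    | |- ptime (fun _ => nilp _) => apply: ptime_nilp
    | |- ptime (fun _ => if _ then _ else _) => apply: ptime_if
    | |- ptime (fun _ => if _ is _ :: _ then _ else _) => apply: ptime_match
    | |- ptime (fun _ => rev _) => apply: ptime_rev
    | |- ptime (fun _ => _ ++ _) => apply: ptime_cat
    | |- ptime (fun _ => flatten _) => apply: ptime_flatten
    | |- ptime (fun _ => map _ _) => apply: ptime_map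
    | |- ptime (fun _ => filter _ _) => apply: ptime_filter
    | |- ptime (fun _ => has _ _) => apply: ptime_has
    end
  | solve_ptime_hook ]; cbv beta.

(** * Equality of numbers, membership and removal *)

Definition bits m := [seq odd (m %/ 2 ^ i) | i <- iota 0 (up_log 2 m.+1)].

(** Equal lengths give a common exponent L. Both numbers are then rebuilt from the most significant
    bit down: the quotients by 2^(L-j) agree by induction on j, starting from 0 = 0. *)
Lemma bits_inj : injective bits.
Proof.
move=> m m' e; have := congr1 size e; rewrite /bits !size_map !size_iota => e2.
set L := up_log 2 m.+1 in e2.
have ltL k : k.+1 <= 2 ^ up_log 2 k.+1 by exact: up_logP.
have bit i : i < L -> odd (m %/ 2 ^ i) = odd (m' %/ 2 ^ i).
  move=> iL; have := congr1 (fun s => nth false s i) e.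
  by rewrite /bits !(nth_map 0) ?size_iota -?e2 // !nth_iota -?e2.
have main j : j <= L -> m %/ 2 ^ (L - j) = m' %/ 2 ^ (L - j).
  elim: j => [|j IH] jL.
    by rewrite subn0 divn_small ?ltL // divn_small // e2 ltL.
  have eL : L - j = (L - j.+1).+1 by lia.
  have := IH (ltnW jL); rewrite eL expnSr !divnMA !divn2 => e3.
  rewrite -[LHS]odd_double_half -[RHS]odd_double_half e3 bit //; lia.
by have := main L (leqnn _); rewrite subnn !divn1.
Qed.

Lemma enc_bits m : enc (bits m) = enc m.
Proof. by []. Qed.

Lemma ptime_bits (X : encT) (f : X -> nat) :
  ptime f -> ptime (fun x => bits (f x)).
Proof. by move=> pf; apply: ptime_recode pf enc_bits. Qed.

Lemma ptime_eqb (X : encT) (f g : X -> bool) :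
  ptime f -> ptime g -> ptime (fun x => f x == g x).
Proof.
move=> pf pg; apply: (ptime_ext (f := fun x => if f x then g x else ~~ g x)).
  by solve_ptime.
by move=> x; case: (f x); case: (g x).
Qed.

(** Shaped as one fold over [s] that consumes [t], so that the fold lemma gives its running time.
    The flag fails when [t] runs out too early; the final test catches a longer [t]. *)
Definition eq_bits (s t : seq bool) :=
  let p := foldl (fun (p : seq bool * bool) x =>
    if p.1 is y :: r then (r, p.2 && (x == y)) else ([::], false)) (t, true) s
  in nilp p.1 && p.2.

Lemma eq_bitsE s t : eq_bits s t = (s == t).
Proof.
pose F (p : seq bool * bool) x :=
  if p.1 is y :: r then (r, p.2 && (x == y)) else ([::], false).
have ff r u : (foldl F (u, false) r).2 = false.
  by elim: r u => // x r IH [|y u] /=; rewrite IH.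
rewrite /eq_bits -/F; elim: s t => [|x s IH] [|y t] //=.
  by rewrite -[F _ x]/([::], false) ff andbF.
rewrite -[F _ x]/(t, x == y) eqseq_cons -IH; case: (x == y) => //=.
by rewrite ff andbF.
Qed.

Lemma ptime_eq_bits (X : encT) (f g : X -> seq bool) :
  ptime f -> ptime g -> ptime (fun x => eq_bits (f x) (g x)).
Proof.
move=> pf pg; rewrite /eq_bits.
pose F (p : seq bool * bool) x :=
  if p.1 is y :: r then (r, p.2 && (x == y)) else ([::], false).
have P : ptime (fun x => foldl F (g x, true) (f x)).
  apply: (@ptime_foldl_grow X _ _ (fun _ => F) (fun x =>
    (g x, true)) f (fun=> 3)).
  - by rewrite /F; solve_ptime; apply: ptime_eqb; solve_ptime.
  - by solve_ptime.
  - by solve_ptime.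
  - exact: polyb_const.
  - move=> x [[|c s] b] y _; rewrite /F /= ?dsize_pair ?dsize_cons;
    first by lia.
    by case: (y == c); rewrite ?andbT ?andbF; case: b; case: c => /=; lia.
by solve_ptime.
Qed.

Lemma ptime_eqn (X : encT) (f g : X -> nat) :
  ptime f -> ptime g -> ptime (fun x => f x == g x).
Proof.
move=> pf pg.
apply: (ptime_ext (ptime_eq_bits (ptime_bits pf) (ptime_bits pg))) => x.
by rewrite eq_bitsE (inj_eq bits_inj).
Qed.

Lemma ptime_eq_arc (X : encT) (f g : X -> nat * nat) :
  ptime f -> ptime g -> ptime (fun x => f x == g x).
Proof.
move=> pf pg; apply: (ptime_ext
  (f := fun x => ((f x).1 == (g x).1) && ((f x).2 == (g x).2))).
  by apply: ptime_andb; apply: ptime_eqn; solve_ptime.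
by move=> x; rewrite -pair_eqE.
Qed.

Section EqType.
Variables (T : eqType) (e : T -> data).
Let Te := EncT e.
Hypothesis eqT : forall (X : encT) (f g : X -> Te),
  ptime f -> ptime g -> ptime (fun x => (f x == g x :> T)).

Lemma ptime_mem_gen (X : encT) (f : X -> Te) (l : X -> seq Te) :
  ptime f -> ptime l -> ptime (fun x => (f x : T) \in (l x : seq T)).
Proof.
move=> pf pl.
apply: (ptime_ext (f := fun x => has (fun y : Te => f x == y :> T) (l x))).
  apply: ptime_has => //; apply: eqT; last by solve_ptime.
  by apply: (ptime_comp pf); solve_ptime.
by move=> x; rewrite -(@has_pred1 T); apply: eq_has => y; apply: eq_sym.
Qed.

Lemma ptime_rem_gen (X : encT) (f : X -> Te) (l : X -> seq Te) :
  ptime f -> ptime l -> ptime (fun x => (rem (f x : T) (l x : seq T) : seq Te)).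
Proof.
move=> pf pl.
(* The flag records that the first occurrence has already been dropped. *)
pose F x (p : seq Te * bool) (y : Te) :=
  if p.2 || (f x != y :> T) then (y :: p.1, p.2) else (p.1, true).
have pF : ptime (fun x => foldl (F x) ([::], false) (l x)).
  have bl := ptime_dsize pl.
  apply: (@ptime_foldl_grow X _ _ F (fun=> ([::], false)) l
    (fun x => dsize (enc (l x)) + 2)) => //; last 2 first.
  - by polyb_tac.
  - move=> x [s b] y le; rewrite /F; case: ifP => _; cbn [fst snd];
    rewrite !dsize_pair ?dsize_cons.
      by move: (dsize (enc b)) => *; lia.
    by case: b => /=; lia.
  - rewrite /F; solve_ptime; apply: eqT; last by solve_ptime.
    by apply: (ptime_comp pf); solve_ptime.
  - exact: ptime_const.
apply: (ptime_ext (ptime_rev (ptime_fst pF))) => x.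
have acc1 s a : rev (foldl (F x) (a, true) s).1 = rev a ++ s.
  elim: s a => [|y s IH] a /=; first by rewrite cats0.
  by rewrite /F /= IH rev_cons cat_rcons.
have acc0 s a : rev (foldl (F x) (a, false) s).1 = rev a ++ rem (f x : T) s.
  elim: s a => [|y s IH] a /=; first by rewrite cats0.
  rewrite {2}/F /= eq_sym; case: eqP => _ /=; first by rewrite acc1.
  by rewrite IH rev_cons cat_rcons.
by rewrite acc0.
Qed.
End EqType.

Lemma ptime_memn (X : encT) (f : X -> nat) (l : X -> seq nat) :
  ptime f -> ptime l -> ptime (fun x => f x \in l x).
Proof. exact: (ptime_mem_gen (e := enc_nat) ptime_eqn). Qed.

Lemma ptime_remn (X : encT) (f : X -> nat) (l : X -> seq nat) :
  ptime f -> ptime l -> ptime (fun x => rem (f x) (l x)).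
Proof. exact: (ptime_rem_gen (e := enc_nat) ptime_eqn). Qed.

Lemma ptime_rem_arc (X : encT) (f : X -> nat * nat) (l : X -> seq (nat * nat)) :
  ptime f -> ptime l -> ptime (fun x => rem (f x) (l x)).
Proof.
exact: (ptime_rem_gen (e := @enc (prod_encT nat_encT nat_encT)) ptime_eq_arc).
Qed.

(** * The algorithm *)

Section Algorithm.
Variable V : eqType.
Implicit Types (A E F M : seq (V * V)) (vs C : seq V)
  (r : seq (V * seq (V * V))).

(* An item (v, N) stands for a matching N in which the tail v has lost a unit.
   A move gives it back, at the head of some arc e of N, which is removed: now
   the tail of e has lost a unit. *)
Definition moves A r : seq (V * seq (V * V)) :=
  flatten [seq flatten [seq [seq (e.1, (it.1, a.2) :: rem e it.2) |
      e <- it.2 & (e.2 == a.2) && (e.1 \notin [seq i.1 | i <- r])] |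
    a <- A & a.1 == it.1] | it <- r].

(** Only one move is taken at a time: two moves may free the same tail, and the tails of the items
    must stay distinct. *)
Definition explore A r := if moves A r is it :: _ then it :: r else r.

(** [vs] is only a clock: the items have distinct tails among the vertices, so |vs| rounds exhaust
    the moves. *)
Definition reach A vs u M := foldl (fun r _ => explore A r) [:: (u, M)] vs.

(** The missing unit of an item is given back at a free head. As the item carries its whole
    matching, no augmenting path has to be traced back. *)
Definition exits A (R : seq V) r :=
  flatten [seq [seq ((it.1, a.2) :: it.2, rem a.2 R) |
    a <- A & (a.1 == it.1) && (a.2 \in R)] | it <- r].

(* A state (M, (R, L)) consists of the matching, the heads that are still free
   and the tails that could not be matched. *)
Definition augment A vs (st : seq (V * V) * (seq V * seq V)) u :=
  if exits A st.2.1 (reach A vs u st.1) is p :: _ then (p.1, (p.2, st.2.2))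
  else (st.1, (st.2.1, u :: st.2.2)).

Definition matching A vs (L R : seq V) :=
  foldl (augment A vs) ([::], (R, [::])) L.

(* The boolean tells whether xs is a sub-multiset of C. *)
Definition remove_all (xs C : seq V) :=
  foldl (fun p x => (rem x p.1, p.2 && (x \in p.1))) (C, true) xs.

Definition attempt A vs F C :=
  matching (A ++ [seq (v, v) | v <- vs]) vs
    (remove_all [seq a.1 | a <- F] C).1 (remove_all [seq a.2 | a <- F] C).1.

Definition success A vs F C :=
  (remove_all [seq a.1 | a <- F] C).2 && (remove_all [seq a.2 | a <- F] C).2 &&
  nilp (attempt A vs F C).2.2.

(* The capacity K is represented by the concatenation of K copies of vs. *)
Definition capacity A vs F :=
  foldl (fun C _ => if success A vs F C then C else vs ++ C) [::] F.

Definition flow A vs F :=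
  F ++ [seq a <- (attempt A vs F (capacity A vs F)).1 | a.1 != a.2].

(* Hierholzer's algorithm, on a state (stack, (unused arcs, circuit)). *)
Definition trail_step (st : seq V * (seq (V * V) * seq V)) :=
  if st.1 is v :: s then
    if [seq a <- st.2.1 | a.1 == v] is a :: _
    then (a.2 :: st.1, (rem a st.2.1, st.2.2))
    else (s, (st.2.1, v :: st.2.2))
  else st.

(* E ++ E ++ [:: (v, v)] only counts the steps: one push per arc, and one pop per
   push. *)
Definition trail E v :=
  (foldl (fun st _ => trail_step st) ([:: v], (E, [::]))
    (E ++ E ++ [:: (v, v)])).2.2.

(** Either direction will do: the bounds on the arcs chosen only involve undirected cuts of the
    tree. *)
Definition orient A (e : seq V) :=
  if [seq a <- A | (a.1 != a.2) && (a.1 \in e) && (a.2 \in e)] is a :: _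
  then [:: a] else [::].

Definition orientation A (T : seq (seq V)) := flatten [seq orient A e | e <- T].

(** A closed trail lists its starting vertex at both ends. Dropping the first entry leaves each
    vertex at most as many visits as arcs entering it. *)
Definition solve vs A T :=
  if vs is v :: _ then
    if trail (flow A vs (orientation A T)) v is _ :: c then c else [::]
  else [::].

Lemma movesP A r i : reflect
  (exists it a e, [/\ it \in r, a \in A /\ a.1 = it.1, e \in it.2 /\ e.2 = a.2,
     e.1 \notin [seq i.1 | i <- r] & i = (e.1, (it.1, a.2) :: rem e it.2)])
  (i \in moves A r).
Proof.
apply: (iffP flatten_mapP) => [[it itr]|].
  case/flatten_mapP=> a; rewrite mem_filter => /andP[/eqP a1 aA].
  case/mapP=> e; rewrite mem_filter => /andP[/andP[/eqP e2 e1] eit] ->.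
  by exists it, a, e.
move=> [it [a [e [itr [aA a1] [eit e2] e1 ->]]]]; exists it => //.
apply/flatten_mapP; exists a; first by rewrite mem_filter a1 eqxx.
by apply/mapP; exists e => //; rewrite mem_filter e2 eqxx e1.
Qed.

Lemma exitsP A (R : seq V) r p : reflect
  (exists it a, [/\ it \in r, a \in A, a.1 = it.1, a.2 \in R
     & p = ((it.1, a.2) :: it.2, rem a.2 R)])
  (p \in exits A R r).
Proof.
apply: (iffP flatten_mapP) => [[it itr]|].
  case/mapP=> a; rewrite mem_filter => /andP[/andP[/eqP a1 aR] aA] ->.
  by exists it, a.
move=> [it [a [itr aA a1 aR ->]]]; exists it => //.
by apply/mapP; exists a => //; rewrite mem_filter a1 eqxx aR.
Qed.
End Algorithm.

(** * Running time of the algorithm *)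

Ltac solve_ptime_hook ::= first
  [ lazymatch goal with
    | |- ptime (fun _ => _ == _) =>
      first [apply: ptime_eqn | apply: ptime_eq_arc]
    | |- ptime (fun _ => _ \in _) => apply: ptime_memn
    | |- ptime (fun _ => rem _ _) =>
      first [apply: ptime_remn | apply: ptime_rem_arc]
    end
  | match goal with
    | H : ptime ?f |- ptime (fun _ => ?f _) => apply: (ptime_comp H)
    end ].

Lemma ptime_moves (X : encT) (A : X -> seq (nat * nat))
    (r : X -> seq (nat * seq (nat * nat))) :
  ptime A -> ptime r -> ptime (fun x => moves (A x) (r x)).
Proof.
by move=> pA pr; rewrite /moves; solve_ptime. Qed.

Lemma ptime_explore (X : encT) (A : X -> seq (nat * nat))
    (r : X -> seq (nat * seq (nat * nat))) :
  ptime A -> ptime r -> ptime (fun x => explore (A x) (r x)).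
Proof. by move=> pA pr; have pm := ptime_moves pA pr; rewrite /explore;
  solve_ptime. Qed.

(** The map [e] separates the two structures: removal takes place in an [eqType], sizes are measured
    in an [encT]. *)
Lemma dsize_rem (T : encT) (U : eqType) (e : U -> T) (x : U) (s : seq U) :
  x \in s ->
  dsize (enc [seq e y | y <- s]) =
  (dsize (enc [seq e y | y <- rem x s]) + dsize (enc (e x))).+1.
Proof.
move=> xs; rewrite !dsize_seq !big_map (perm_big _ (perm_to_rem xs)) big_cons
  /=.
lia.
Qed.

Definition dsize_remn (x : nat) (s : seq nat) := @dsize_rem nat_encT nat id x s.
Definition dsize_rem_arc (x : nat * nat) (s : seq (nat * nat)) :=
  @dsize_rem (prod_encT nat_encT nat_encT) _ id x s.

(* A move swaps the free vertex of an item with the tail of one of its arcs. *)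
Lemma dsize_moves (A : seq (nat * nat)) r i : i \in moves A r ->
  exists2 it, it \in r & dsize (enc i) = dsize (enc it).
Proof.
case/movesP=> it [a [e [itr [_ _] [eit e2] _ ->]]]; exists it => //.
have := dsize_rem_arc eit; rewrite !map_id.
case: it {itr} eit => v N eN; case: e e2 eN => e1 e2 /= -> eN E.
by rewrite E; lia.
Qed.

(** All items have the size B of the initial one, so a round lengthens the list by at most B + 1,
    although every item holds a full matching. *)
Lemma dsize_reach (A : seq (nat * nat)) (ws : seq nat) (u : nat)
    (M : seq (nat * nat)) i :
  dsize (enc (foldl (fun r _ => explore A r) [:: (u, M)] (take i ws))) <=
  dsize (enc ws) * (dsize (enc (u, M))).+1 + (dsize (enc (u, M))).+2.
Proof.
set B := dsize (enc (u, M)); set r0 := [:: (u, M)].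
have main (s : seq nat) : let r := foldl (fun r _ => explore A r) r0 s in
    dsize (enc r) <= size s * B.+1 + B.+2 /\
    {in r, forall it, dsize (enc it) = B}.
  elim/last_ind: s => [|s y [IH1 IH2]].
    split=> [|it]; last by rewrite inE => /eqP ->.
    by rewrite mul0n /r0 dsize_cons -/B -[dsize (enc [::])]/1; lia.
  cbv zeta; rewrite foldl_rcons size_rcons {1 3}/explore.
  set r := foldl _ _ s in IH1 IH2 *.
  case mr: (moves A r) => [|it r']; first by split=> //; rewrite mulSn; lia.
  have [|it' /IH2 iB E] := @dsize_moves A r it; first by rewrite mr mem_head.
  split=> [|j]; first by rewrite dsize_cons E iB mulSn; lia.
  by rewrite inE => /predU1P[->|/IH2 //]; rewrite E.
have [le _] := main (take i ws); apply: leq_trans le _.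
rewrite leq_add2r leq_mul // (leq_trans _ (ltnW (size_dsize ws))) //.
by rewrite size_take_min geq_minr.
Qed.

Lemma ptime_reach (X : encT) (A : X -> seq (nat * nat)) (vs : X -> seq nat)
    (u : X -> nat) (M : X -> seq (nat * nat)) :
  ptime A -> ptime vs -> ptime u -> ptime M ->
  ptime (fun x => reach (A x) (vs x) (u x) (M x)).
Proof.
move=> pA pvs pu pM; rewrite /reach.
apply: (ptime_foldl _ _ _ _ (fun x i =>
  dsize_reach (A x) (vs x) (u x) (M x) i)).
- by apply: ptime_explore; solve_ptime.
- by solve_ptime.
- by solve_ptime.
- have b1 := ptime_dsize pvs; have b2 := ptime_dsize (ptime_pair pu pM).
  apply: (polyb_le (h' := fun x =>
    dsize (enc (vs x)) * (1 + dsize (enc (u x, M x)))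
     + (2 + dsize (enc (u x, M x))))) => [x|]; last by polyb_tac.
  by rewrite !addSn !add0n.
Qed.

Lemma ptime_exits (X : encT) (A : X -> seq (nat * nat)) (R : X -> seq nat)
    (r : X -> seq (nat * seq (nat * nat))) :
  ptime A -> ptime R -> ptime r -> ptime (fun x => exits (A x) (R x) (r x)).
Proof. by move=> pA pR pr; rewrite /exits; solve_ptime. Qed.

Lemma ptime_augment (X : encT) (A : X -> seq (nat * nat)) (vs : X -> seq nat)
    (st : X -> seq (nat * nat) * (seq nat * seq nat)) (u : X -> nat) :
  ptime A -> ptime vs -> ptime st -> ptime u ->
  ptime (fun x => augment (A x) (vs x) (st x) (u x)).
Proof.
move=> pA pvs pst pu; rewrite /augment.
have p1 : ptime (fun x => (st x).1) by solve_ptime.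
have p2 : ptime (fun x => (st x).2.1) by solve_ptime.
have p3 := ptime_exits pA p2 (ptime_reach pA pvs pu p1).
by solve_ptime.
Qed.

Lemma mem_reach (A : seq (nat * nat)) (vs : seq nat) u M it :
  it \in reach A vs u M -> dsize (enc it) = dsize (enc (u, M)).
Proof.
rewrite /reach; elim/last_ind: vs it => [|vs y IH] it.
  by rewrite inE => /eqP ->.
rewrite foldl_rcons {1}/explore; set r := foldl _ _ vs in IH *.
case mr: (moves A r) => [|i r']; first exact: IH.
rewrite inE => /predU1P[->|]; last exact: IH.
have [|j /IH jE ->] := @dsize_moves A r i; last exact: jE.
by rewrite mr mem_head.
Qed.

(** Nothing is duplicated: success moves [u] and a free head into the matching, failure moves [u] to
    the unmatched tails. The growth is thus additive in [u]. *)
Lemma dsize_augment (A : seq (nat * nat)) (vs : seq nat) st (u : nat) :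
  dsize (enc (augment A vs st u)) <= dsize (enc st) + dsize (enc u) + 1.
Proof.
case: st => M [R L]; rewrite /augment; cbn [fst snd].
case ex: exits => [|p ?]; rewrite !dsize_pair; first by rewrite dsize_cons; lia.
have /exitsP[it [a [/mem_reach E aA a1 aR ->]]] :
  p \in exits A R (reach A vs u M) by rewrite ex mem_head.
cbn [fst snd].
have := dsize_remn aR; rewrite !map_id => E2.
case: it E a1 => v N; rewrite !dsize_pair => E _.
rewrite !dsize_cons !dsize_pair; cbn [fst snd]; move: E E2.
move: (dsize (enc v)) (dsize (enc N)) (dsize (enc u)) (dsize (enc M)) (dsize
  (enc a.2)).
by move: (dsize (enc L)) (dsize (enc R)) (dsize (enc (rem a.2 R))); lia.
Qed.

Lemma ptime_matching (X : encT) (A : X -> seq (nat * nat)) (vs L R : X -> seq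
  nat) :
  ptime A -> ptime vs -> ptime L -> ptime R ->
  ptime (fun x => matching (A x) (vs x) (L x) (R x)).
Proof.
move=> pA pvs pL pR; have bL := ptime_dsize pL; rewrite /matching.
apply: (ptime_foldl_grow (h := fun x => dsize (enc (L x)) + 1)).
- by apply: ptime_augment; solve_ptime.
- by solve_ptime.
- by solve_ptime.
- by polyb_tac.
- by move=> x st u le; apply: leq_trans (dsize_augment _ _ _ _) _; lia.
Qed.

Lemma dsize_rem_le (x : nat) (s : seq nat) :
  dsize (enc (rem x s)) <= dsize (enc s).
Proof.
have [/dsize_remn|xs] := boolP (x \in s); last by rewrite rem_id.
by rewrite !map_id => ->; rewrite leqW // leq_addr.
Qed.

Lemma ptime_remove_all (X : encT) (xs C : X -> seq nat) :
  ptime xs -> ptime C -> ptime (fun x => remove_all (xs x) (C x)).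
Proof.
move=> pxs pC; rewrite /remove_all.
apply: (ptime_foldl_grow (h := fun=> 2)); try by solve_ptime.
- exact: polyb_const.
- move=> x [s b] y _; rewrite !dsize_pair.
  have := dsize_rem_le y s; cbn [fst snd].
  have : dsize (enc (b && (y \in s))) <= dsize (enc b) + 2.
    by case: b; case: (y \in s).
  move: (dsize (enc b)) (dsize (enc s)) (dsize (enc (rem y s))).
  by move: (dsize (enc (b && _))); lia.
Qed.

Lemma ptime_attempt (X : encT) (A : X -> seq (nat * nat)) (vs : X -> seq nat)
    (F : X -> seq (nat * nat)) (C : X -> seq nat) :
  ptime A -> ptime vs -> ptime F -> ptime C ->
  ptime (fun x => attempt (A x) (vs x) (F x) (C x)).
Proof.
move=> pA pvs pF pC; apply: ptime_matching; try by solve_ptime.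
  by apply/ptime_fst/ptime_remove_all; solve_ptime.
by apply/ptime_fst/ptime_remove_all; solve_ptime.
Qed.

Lemma ptime_success (X : encT) (A : X -> seq (nat * nat)) (vs : X -> seq nat)
    (F : X -> seq (nat * nat)) (C : X -> seq nat) :
  ptime A -> ptime vs -> ptime F -> ptime C ->
  ptime (fun x => success (A x) (vs x) (F x) (C x)).
Proof.
move=> pA pvs pF pC; rewrite /success; have pa := ptime_attempt pA pvs pF pC.
do ?apply: ptime_andb; try by solve_ptime.
  by apply/ptime_snd/ptime_remove_all; solve_ptime.
by apply/ptime_snd/ptime_remove_all; solve_ptime.
Qed.

Lemma dsize_cat (X : encT) (s t : seq X) :
  dsize (enc (s ++ t)) <= dsize (enc s) + dsize (enc t).
Proof.
elim: s => [|x s IH]; first by rewrite leq_addl.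
by rewrite cat_cons !dsize_cons; lia.
Qed.

Lemma ptime_capacity (X : encT) (A : X -> seq (nat * nat)) (vs : X -> seq nat)
    (F : X -> seq (nat * nat)) :
  ptime A -> ptime vs -> ptime F ->
  ptime (fun x => capacity (A x) (vs x) (F x)).
Proof.
move=> pA pvs pF; have bvs := ptime_dsize pvs; rewrite /capacity.
apply: (ptime_foldl_grow (h := fun x => dsize (enc (vs x))));
  try by solve_ptime.
  by solve_ptime; apply: ptime_success; solve_ptime.
move=> x C _ _; case: ifP => _; first exact: leq_addr.
by rewrite addnC; apply: dsize_cat.
Qed.

Lemma ptime_flow (X : encT) (A : X -> seq (nat * nat)) (vs : X -> seq nat)
    (F : X -> seq (nat * nat)) :
  ptime A -> ptime vs -> ptime F -> ptime (fun x => flow (A x) (vs x) (F x)).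
Proof.
move=> pA pvs pF; rewrite /flow; have pC := ptime_capacity pA pvs pF.
by have pa := ptime_attempt pA pvs pF pC; solve_ptime.
Qed.

(** A push moves the head of an arc to the stack and discards its tail; a pop moves a vertex from
    the stack to the circuit. *)
Lemma dsize_trail_step (st : seq nat * (seq (nat * nat) * seq nat)) :
  dsize (enc (trail_step st)) <= dsize (enc st).
Proof.
case: st => [[|v s] [R c]] //; rewrite /trail_step; cbn [fst snd].
case fR: filter => [|a l]; rewrite !dsize_pair !dsize_cons; first by lia.
have aR : a \in R.
  by have := mem_head a l; rewrite -fR mem_filter => /andP[].
have := dsize_rem_arc aR; rewrite !map_id; case: a {fR aR} => a1 a2 ->.
rewrite !dsize_pair; cbn [fst snd].
move: (dsize (enc a1)) (dsize (enc a2)) (dsize (enc s)) (dsize (enc v)) (dsize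
  (enc c)).
by move: (dsize (enc (rem (a1, a2) R))); lia.
Qed.

Lemma ptime_trail (X : encT) (E : X -> seq (nat * nat)) (v : X -> nat) :
  ptime E -> ptime v -> ptime (fun x => trail (E x) (v x)).
Proof.
move=> pE pv; rewrite /trail; apply/ptime_snd/ptime_snd.
apply: (ptime_foldl_grow (h := fun=> 0)); try by solve_ptime.
- by rewrite /trail_step; solve_ptime.
- exact: polyb_const.
- by move=> x st _ _; rewrite addn0; apply: dsize_trail_step.
Qed.

Lemma ptime_solve (X : encT) (vs : X -> seq nat) (A : X -> seq (nat * nat))
    (T : X -> seq (seq nat)) :
  ptime vs -> ptime A -> ptime T -> ptime (fun x => solve (vs x) (A x) (T x)).
Proof.
move=> pvs pA pT; rewrite /solve.
have pF : ptime (fun x => orientation (A x) (T x)).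
  by rewrite /orientation /orient; solve_ptime.
have pE := ptime_flow pA pvs pF.
solve_ptime; apply: ptime_trail; last by solve_ptime.
exact: (ptime_comp pE (ptime_fst (ptime_id _))).
Qed.

(** * Correctness of the algorithm *)

Section Trail.
Variable V : eqType.
Implicit Types (E R : seq (V * V)) (s c : seq V).

(* rev s ++ c is a walk, except that between the top v of the stack s and the
   first vertex of c a trail from v to b, made of unused arcs, is missing. *)
Definition trail_inv E v0 (st : seq V * (seq (V * V) * seq V)) : Prop :=
  let: (s, (R, c)) := st in
  [/\ perm_eq (s ++ c ++ unzip2 R) (v0 :: unzip2 E),
      forall a, a \in E -> a \in R \/ (a.1 \in s ++ c) && (a.2 \in s ++ c),
      {subset R <= E}, forall a, a \in R -> a.1 \notin c
    & if s is v :: s' then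
        [/\ last v s' = v0, path (fun x y => (y, x) \in E) v s'
          & exists b, [/\ perm_eq (b :: unzip1 R) (v :: unzip2 R),
              path (fun x y => (x, y) \in E) b c & last b c = v0]]
      else perm_eq (unzip1 R) (unzip2 R) /\
        exists c', [/\ c = v0 :: c', path (fun x y => (x, y) \in E) v0 c'
          & last v0 c' = v0]].

Lemma trail_inv_step E v0 st : trail_inv E v0 st -> trail_inv E v0 (trail_step
  st).
Proof.
case: st => [[|v s] [R c]] // [pm us RE fin [ls ps [b [bal pb lb]]]].
rewrite /trail_step /=; case fR: filter => [|a l].
  have bv : b = v.
    have : v \in b :: unzip1 R by rewrite (perm_mem bal) mem_head.
    rewrite inE => /orP[/eqP->//|/mapP[a aR va]].
    have : a \in [seq a <- R | a.1 == v] by rewrite mem_filter aR va eqxx.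
    by rewrite fR.
  subst b.
  have mvE x : (x \in s ++ v :: c) = (x \in (v :: s) ++ c).
    by rewrite !(mem_cat, inE) orbCA orbA.
  split=> //.
  - apply: perm_trans pm.
    by rewrite -[(v :: c) ++ _]/([:: v] ++ (c ++ unzip2 R)) perm_catCA.
  - by move=> a /us; rewrite !mvE.
  - move=> a aR; rewrite inE negb_or fin // andbT; apply/negP => av.
    have : a \in [seq a <- R | a.1 == v] by rewrite mem_filter aR av.
    by rewrite fR.
  - rewrite perm_cons in bal; case: s ls ps {pm us mvE} => [|v' s] ls ps.
      by rewrite -(ls : v = v0); split=> //; exists c; split=> //;
        rewrite lb -ls.
    move: ps => /andP[e ps]; split=> //; exists v'.
    by split=> //; [rewrite perm_cons|rewrite /= e].
have : a \in [seq a <- R | a.1 == v] by rewrite fR mem_head.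
rewrite mem_filter => /andP[/eqP av aR].
have pR := perm_to_rem aR.
split.
- apply: perm_trans pm.
  have p2 : perm_eq (unzip2 R) (a.2 :: unzip2 (rem a R))
    by apply: (perm_map snd pR).
  by apply/permP => P; have := permP p2 P; rewrite /= !count_cat /=; lia.
- move=> e /us[]; last first.
    by move=> /andP[e1 e2]; right;
      rewrite cat_cons [e.1 \in _]inE [e.2 \in _]inE e1 e2 !orbT.
  rewrite (perm_mem pR) inE => /orP[/eqP->|]; last by left.
  by right; rewrite /= !inE av !eqxx !orbT.
- by move=> e /mem_rem/RE.
- by move=> e /mem_rem/fin.
- split=> //; first by rewrite /= ps -av -surjective_pairing RE.
  exists b; split=> //; move: bal; rewrite -av.
  have p1 : perm_eq (unzip1 R) (a.1 :: unzip1 (rem a R))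
    by apply: (perm_map fst pR).
  have p2 : perm_eq (unzip2 R) (a.2 :: unzip2 (rem a R))
    by apply: (perm_map snd pR).
  move=> /permP bal; apply/permP => P.
  by have := bal P; have := permP p1 P; have := permP p2 P; rewrite /=; lia.
Qed.

(** Connectivity is not assumed. The last clause says that the visited set is closed along arcs in
    both directions, so the trail covers the component of [v0]. *)
Lemma trailP E v0 : perm_eq (unzip1 E) (unzip2 E) ->
  exists c, [/\ trail E v0 = v0 :: c, path (fun x y => (x, y) \in E) v0 c,
    last v0 c = v0, forall v, count_mem v c <= count_mem v (unzip2 E)
    & forall a, a \in E -> (a.1 \in v0 :: c) = (a.2 \in v0 :: c)].
Proof.
move=> bal; rewrite /trail; set z := ([:: v0], (E, [::])).
set fuel := E ++ _.
have sz : size fuel = (size E).*2.+1 by rewrite !size_cat /=; lia.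
have i0 : trail_inv E v0 z.
  split=> //=; [by move=> a; left|split=> //].
  by exists v0; rewrite perm_cons; split.
(* A push lowers [(size R).*2] by 2 and lengthens the stack by 1; a pop shortens the stack by 1.
   Each step thus costs exactly one unit of fuel. *)
have main (f : seq (V * V)) : let st := foldl (fun st _ => trail_step st) z f in
    trail_inv E v0 st /\ (st.1 = [::] \/ size f + (size st.2.1).*2 + size st.1
      = (size E).*2.+1).
  elim/last_ind: f => [|f a [IH1 IH2]].
    by split=> //; right; rewrite /= add0n addn1.
  cbv zeta; rewrite foldl_rcons; split; first exact: trail_inv_step.
  case: (foldl _ _ _) IH1 IH2 => [[|v s] [R c]] inv; first by left.
  case=> // e; right; rewrite /trail_step /=; case fR: filter => [|b l].
    by rewrite size_rcons /= in e *; lia.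
  have : b \in [seq a <- R | a.1 == v] by rewrite fR mem_head.
  rewrite mem_filter => /andP[_ bR]; rewrite /= size_rem // size_rcons.
  have : 0 < size R by case: (R) bR.
  by move: e; rewrite /=; move: (size R) (size E) (size f) (size s) => *; lia.
have := main fuel; case: foldl => s [R c] /= [inv fin].
have s0 : s = [::] by case: fin => [//|]; rewrite sz; case: (s) => //= *; lia.
subst s; case: inv => pm us RE nc [balR [c' [cE pc lc]]]; subst c; exists c'.
split=> //.
  move=> v; move/permP/(_ (pred1 v)): pm => /=; rewrite count_cat; lia.
move=> a /us[aR|/andP[-> ->] //].
rewrite (negPf (nc _ aR)); apply/esym/negbTE.
have : a.2 \in unzip1 R by rewrite (perm_mem balR) (map_f snd).
by case/mapP => a' /nc + ->.
Qed.
End Trail.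

Lemma sub_in_count (T : eqType) (P Q : pred T) (s : seq T) :
  {in s, forall x, P x -> Q x} -> count P s <= count Q s.
Proof.
elim: s => //= x s IH PQ; rewrite leq_add ?IH //.
  by case: (P x) (PQ x (mem_head _ _)) => // ->.
by move=> y ys; apply: PQ; rewrite inE ys orbT.
Qed.

(** * Augmenting paths and Hall's condition *)

Section Matching.
Variables (V : eqType) (A : seq (V * V)) (vs : seq V).
Implicit Types (M : seq (V * V)) (r : seq (V * seq (V * V))) (u : V).
Hypothesis Avs : forall a, a \in A -> (a.1 \in vs) && (a.2 \in vs).

(** The last clause compares every item with the original [M]: an arc of [M] that an item has lost
    has a reached tail. It turns the absence of moves into a statement about [M] itself. *)
Definition reach_inv u M r : Prop :=
  [/\ uniq (unzip1 r), u \in unzip1 r, {subset unzip1 r <= vs}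
    & forall it, it \in r ->
      [/\ perm_eq (it.1 :: unzip1 it.2) (u :: unzip1 M),
          perm_eq (unzip2 it.2) (unzip2 M), {subset it.2 <= A}
        & forall e, e \in M -> (e \in it.2) || (e.1 \in unzip1 r)]].

Lemma explore_inv u M r : reach_inv u M r -> reach_inv u M (explore A r).
Proof.
move=> [ur u_r rvs it_r]; rewrite /explore; case mr: moves => [|i r'] //.
have /movesP[it [a [e [itr [aA a1] [eit e2] e1 iE]]]] : i \in moves A r.
  by rewrite mr mem_head.
have [p1 p2 itA Mit] := it_r _ itr.
have p := perm_to_rem eit.
have q1 : perm_eq (unzip1 it.2) (e.1 :: unzip1 (rem e it.2)) := perm_map fst p.
have q2 : perm_eq (unzip2 it.2) (e.2 :: unzip2 (rem e it.2)) := perm_map snd p.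
split=> [|||j].
- by rewrite /= ur andbT iE.
- by rewrite inE u_r orbT.
- by move=> v; rewrite inE iE => /orP[/eqP->|/rvs//];
  case/andP: (Avs (itA _ eit)).
rewrite inE => /orP[/eqP->|jr]; last first.
  have [? ? jA Mj] := it_r _ jr; split=> // f /Mj /orP[->//|fr].
  by rewrite inE fr !orbT.
rewrite iE /=; split.
- apply: perm_trans p1; apply/permP => P.
  by have := permP q1 P; rewrite /= => ->; lia.
- apply: perm_trans p2; apply/permP => P.
  by have := permP q2 P; rewrite /= => ->; rewrite e2.
- move=> f; rewrite inE => /orP[/eqP->|/mem_rem/itA//].
  by rewrite -a1 -surjective_pairing.
- move=> f /Mit; rewrite (perm_mem p) !inE => /orP[/orP[/eqP->|->]|->].
  + by rewrite eqxx !orbT.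
  + by rewrite orbT.
  + by rewrite !orbT.
Qed.

(** Until no move is left, every round adds a new tail. If this lasted for |vs| rounds there would
    be |vs| + 1 distinct tails in [vs]. *)
Lemma reachP u M : u \in vs -> {subset M <= A} ->
  reach_inv u M (reach A vs u M) /\ moves A (reach A vs u M) = [::].
Proof.
move=> uvs MA.
pose st (s : seq V) := foldl (fun r _ => explore A r) [:: (u, M)] s.
have inv s : reach_inv u M (st s).
  rewrite /st; elim/last_ind: s => [|s x IH]; last by rewrite foldl_rcons;
    apply: explore_inv.
  split; rewrite ?mem_head // => v; rewrite inE => /eqP-> //.
  by split=> // e eM; rewrite eM.
split; first exact: inv.
have grow s : moves A (st s) = [::] \/ size (st s) = (size s).+1.
  rewrite /st; elim/last_ind: s => [|s x [IH|IH]]; first by right.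
    by left; rewrite foldl_rcons; set r := foldl _ _ _ in IH *;
      rewrite /explore IH.
  rewrite foldl_rcons size_rcons; set r := foldl _ _ _ in IH *.
  rewrite /explore; case mr: (moves A r) => [|i r']; first by left; rewrite mr.
  by right; rewrite /= IH.
have [//|sz] := grow vs; have [ur _ rvs _] := inv vs.
have := uniq_leq_size ur rvs; rewrite size_map; rewrite /st in sz; rewrite sz.
by rewrite ltnn.
Qed.

Lemma augmentP st u : u \in vs -> {subset st.1 <= A} ->
  let st' := augment A vs st u in
  [/\ perm_eq (unzip1 st'.1 ++ st'.2.2) (u :: unzip1 st.1 ++ st.2.2),
      perm_eq (unzip2 st'.1 ++ st'.2.1) (unzip2 st.1 ++ st.2.1)
    & {subset st'.1 <= A}].
Proof.
case: st => M [R L] /= uvs MA; rewrite /augment /=.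
have [[_ _ _ it_r] _] := reachP uvs MA.
case ex: exits => [|p ?] /=.
  by split=> //; apply/permP => P; rewrite /= !count_cat /=; lia.
have /exitsP[it [a [itr aA a1 aR ->]]] : p \in exits A R (reach A vs u M).
  by rewrite ex mem_head.
have [p1 p2 itA _] := it_r _ itr.
split=> /=.
- by rewrite -cat_cons -[u :: _]cat_cons perm_cat2r.
- rewrite -cat_cons; apply/permP => P; rewrite !count_cat /= (permP p2).
  by have /permP/(_ P) := perm_to_rem aR; rewrite /= => ->; lia.
- move=> f; rewrite inE => /orP[/eqP->|/itA//].
  by rewrite -a1 -surjective_pairing.
Qed.

Lemma matchingP L R : {subset L <= vs} ->
  let st := matching A vs L R in
  [/\ perm_eq (unzip1 st.1 ++ st.2.2) L, perm_eq (unzip2 st.1 ++ st.2.1) R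
    & {subset st.1 <= A}].
Proof.
rewrite /matching; elim/last_ind: L => [|L u IH] Lvs; first by split.
cbv zeta; rewrite foldl_rcons; set st := foldl _ _ L in IH *.
have [|p1 p2 sA] := IH; first by move=> v vL;
  rewrite Lvs // mem_rcons inE vL orbT.
have uvs : u \in vs by rewrite Lvs // mem_rcons mem_head.
have [q1 q2 sA'] := augmentP uvs sA; split=> //.
  by apply: perm_trans q1 _; rewrite perm_sym perm_rcons perm_cons perm_sym.
exact: perm_trans q2 p2.
Qed.

(** A single step, not a closure: the neighbourhood of the tails in [S] in the bipartite graph of
    tails and heads. *)
Definition reachable (S : pred V) : pred V :=
  fun w => has (fun a => S a.1 && (a.2 == w)) A.

(** [S] is the set of reached tails. No head next to it is free, and an arc of [M] into such a head
    has its tail in [S], since otherwise a move would be left. *)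
Lemma exits_nil M R u : u \in vs -> {subset M <= A} ->
  exits A R (reach A vs u M) = [::] ->
  exists S : pred V, [/\ S u, forall w, w \in R -> ~~ reachable S w
    & forall e, e \in M -> reachable S e.2 -> S e.1].
Proof.
move=> uvs MA ex; have [[ur u_r rvs it_r] mv] := reachP uvs MA.
set r := reach _ _ _ _ in ex ur u_r rvs it_r mv.
exists (mem (unzip1 r)); split=> //.
  move=> w wR; apply/hasPn => a aA; apply/andP => -[/mapP[it itr a1] /eqP a2].
  have : ((it.1, a.2) :: it.2, rem a.2 R) \in exits A R r.
    by apply/exitsP; exists it, a; split=> //; rewrite a2.
  by rewrite ex.
move=> e eM /hasP[a aA /andP[/mapP[it itr a1] /eqP a2]].
have [_ _ _ Mit] := it_r _ itr.
case/orP: (Mit _ eM) => // eit; apply/negPn/negP => e1.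
have : (e.1, (it.1, a.2) :: rem e it.2) \in moves A r.
  by apply/movesP; exists it, a, e; split.
by rewrite mv.
Qed.

(** The hypothesis is Hall's condition for [L] against [R], the parts of [C] left by [F], with the
    subtracted terms moved across because natural subtraction truncates. At a first failure, [S]
    holds at least one more unit of [L] than its neighbourhood has heads in [R]. *)
Lemma matching_complete L R (F : seq (V * V)) (C : seq V) :
  {subset L <= vs} ->
  perm_eq (unzip1 F ++ L) C -> perm_eq (unzip2 F ++ R) C ->
  (forall S : pred V, count S C + count (reachable S) (unzip2 F) <=
     count (reachable S) C + count S (unzip1 F)) ->
  (matching A vs L R).2.2 = [::].
Proof.
move=> Lvs pL pR hall.
have main s t : L = s ++ t -> (matching A vs s R).2.2 = [::].
  elim/last_ind: s t => [|s u IH] t // Lst.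
  have := IH (u :: t); rewrite -cat_rcons => /(_ Lst).
  rewrite /matching foldl_rcons -/(matching _ _ _ _).
  have sL : {subset s <= vs}.
    by move=> v vs'; rewrite Lvs // Lst mem_cat mem_rcons inE vs' orbT.
  have uvs : u \in vs by rewrite Lvs // Lst mem_cat mem_rcons inE eqxx.
  have [p1 p2 sA] := matchingP R sL.
  case: matching p1 p2 sA => M [R' L'] /= p1 p2 sA L0; subst L';
    rewrite cats0 in p1.
  rewrite /augment /=; case ex: exits => [|//]; exfalso.
  have [S [Su SR SM]] := exits_nil uvs sA ex.
  have c1 := permP pL S; have c2 := permP pR (reachable S).
  have c3 := permP p1 S; have c4 := permP p2 (reachable S).
  have c5 : count (reachable S) R' = 0.
    by apply/eqP; rewrite -leqn0 leqNgt -has_count; apply/hasPn.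
  have c6 : count (reachable S) (unzip2 M) <= count S (unzip1 M).
    by rewrite !count_map; apply: sub_in_count => e eM /=; apply: SM.
  have := hall S; move: c1 c2 c3 c4.
  rewrite Lst !count_cat -cats1 !count_cat /= Su; lia.
by apply: (main L [::]); rewrite cats0.
Qed.
End Matching.

Lemma remove_allP (V : eqType) (xs C : seq V) :
  (remove_all xs C).2 -> perm_eq (xs ++ (remove_all xs C).1) C.
Proof.
rewrite /remove_all; elim/last_ind: xs => [|xs x IH] //.
rewrite foldl_rcons; case: foldl IH => D b /= IH /andP[/IH p xD].
rewrite cat_rcons; apply: perm_trans p; rewrite perm_cat2l perm_sym.
exact: perm_to_rem.
Qed.

Lemma remove_all_success (V : eqType) (xs C : seq V) :
  (forall v, count_mem v xs <= count_mem v C) -> (remove_all xs C).2.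
Proof.
rewrite /remove_all; elim/last_ind: xs => [|xs x IH] // le.
have {}IH : (remove_all xs C).2.
  by apply: IH => v; apply: leq_trans (le v); rewrite -cats1 count_cat leq_addr.
have p := remove_allP IH; rewrite /remove_all in p IH.
rewrite foldl_rcons /= IH /= -has_pred1 has_count.
have := permP p (pred1 x); have := le x; rewrite -cats1 !count_cat /= eqxx; lia.
Qed.

(** * Balanced multisets of arcs containing F *)

Section Flow.
Variables (V : eqType) (A : seq (V * V)) (vs : seq V) (F : seq (V * V)).
Hypothesis Avs : forall a, a \in A -> (a.1 \in vs) && (a.2 \in vs).
Hypothesis FA : {subset F <= A}.
Hypothesis vs_uniq : uniq vs.

Let loops := [seq (v, v) | v <- vs].
Let copies k := flatten (nseq k vs).

Definition hall K := forall S : pred V,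
  K * count S vs + count (reachable (A ++ loops) S) (unzip2 F) <=
  K * count (reachable (A ++ loops) S) vs + count S (unzip1 F).

Lemma count_copies P k : count P (copies k) = k * count P vs.
Proof. by elim: k => // k IH; rewrite /copies /= count_cat mulSn -IH. Qed.

Lemma copies_sub k : {subset copies k <= vs}.
Proof. by move=> v; elim: k => // k IH;
  rewrite /copies /= mem_cat => /orP[|/IH]. Qed.

Lemma ends_loops a : a \in A ++ loops -> (a.1 \in vs) && (a.2 \in vs).
Proof. by rewrite mem_cat => /orP[/Avs//|/mapP[v vvs ->]]; rewrite vvs. Qed.

Lemma remove_all_sub (xs C : seq V) : {subset (remove_all xs C).1 <= C}.
Proof.
rewrite /remove_all; elim/last_ind: xs => [|xs x IH] v //.
by rewrite foldl_rcons /= => /mem_rem/IH.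
Qed.

Lemma success_complete K :
  (forall v, count_mem v (unzip1 F) <= K) -> (forall v, count_mem v (unzip2 F)
    <= K) ->
  hall K -> success A vs F (copies K).
Proof.
move=> d1 d2 hallK.
have ok (s : seq V) : {subset s <= vs} -> (forall v, count_mem v s <= K) ->
    (remove_all s (copies K)).2.
  move=> svs ds; apply: remove_all_success => v; rewrite count_copies.
  have [/svs vvs|/count_memPn -> //] := boolP (v \in s).
  by rewrite (count_uniq_mem v vs_uniq) vvs muln1.
have k1 : (remove_all (unzip1 F) (copies K)).2.
  by apply: ok => // v /mapP[a /FA /Avs/andP[av _] ->].
have k2 : (remove_all (unzip2 F) (copies K)).2.
  by apply: ok => // v /mapP[a /FA /Avs/andP[_ av] ->].
rewrite /success /attempt k1 k2 /=.
rewrite (matching_complete (A := A ++ loops) ends_loops (F := F) (C := copies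
  K)) //.
- by move=> v /remove_all_sub/copies_sub.
- exact: remove_allP.
- exact: remove_allP.
- by move=> S; rewrite !count_copies; apply: hallK.
Qed.

(** When no tail is left, counting leaves no free head, so tails and heads of [F] and the matching
    both make up [k] copies of [vs]. A loop contributes equally to both, so dropping loops keeps the
    balance. *)
Lemma attempt_sound k : success A vs F (copies k) ->
  let E := F ++ [seq a <- (attempt A vs F (copies k)).1 | a.1 != a.2] in
  [/\ perm_eq (unzip1 E) (unzip2 E), {subset E <= A}
    & forall v, count_mem v (unzip2 E) <= k].
Proof.
case/andP=> /andP[/remove_allP p1 /remove_allP p2] /nilP L0; cbv zeta.
set L := (remove_all [seq a.1 | a <- F] (copies k)).1 in p1 *.
set R := (remove_all [seq a.2 | a <- F] (copies k)).1 in p2 *.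
have Lvs : {subset L <= vs} by move=> v /remove_all_sub/copies_sub.
have [q1 q2 sA] := matchingP ends_loops R Lvs.
rewrite -/(attempt A vs F (copies k)) in q1 q2 sA *; rewrite L0 cats0 in q1.
case: (attempt _ _ _ _) q1 q2 sA => M [R' L'] /= q1 q2 sA.
have R0 : R' = [::].
  apply/eqP; rewrite -size_eq0; have := perm_size p1; have := perm_size p2.
  have := perm_size q1; have := perm_size q2; rewrite !size_cat !size_map; lia.
rewrite R0 cats0 in q2.
pose NL := [seq a <- M | a.1 != a.2]; pose LL := [seq a <- M | ~~ (a.1 != a.2)].
have pM : perm_eq (NL ++ LL) M by apply/permPl; apply: perm_filterC.
have LLe : unzip1 LL = unzip2 LL.
  by apply/eq_in_map => a; rewrite mem_filter negbK => /andP[/eqP].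
have c1 P : count P (unzip1 F) + count P (unzip1 NL) + count P (unzip1 LL) =
  count P (copies k).
  have := permP p1 P; have := permP q1 P; have := permP (perm_map fst pM) P.
  rewrite map_cat !count_cat -/unzip1; lia.
have c2 P : count P (unzip2 F) + count P (unzip2 NL) + count P (unzip2 LL) =
  count P (copies k).
  have := permP p2 P; have := permP q2 P; have := permP (perm_map snd pM) P.
  rewrite map_cat !count_cat -/unzip2; lia.
have u1 : unzip1 (F ++ NL) = unzip1 F ++ unzip1 NL by rewrite /unzip1 map_cat.
have u2 : unzip2 (F ++ NL) = unzip2 F ++ unzip2 NL by rewrite /unzip2 map_cat.
rewrite -/NL u1 u2; split.
- apply/permP => P; rewrite !count_cat.
  by have := c1 P; have := c2 P; rewrite LLe; lia.
- move=> a; rewrite mem_cat => /orP[/FA//|];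
  rewrite mem_filter => /andP[na /sA].
  rewrite mem_cat => /orP[//|/mapP[v _ av]]; by rewrite av eqxx in na.
- move=> v; have := c2 (pred1 v); rewrite count_copies count_cat.
  have : k * count_mem v vs <= k.
    by rewrite count_uniq_mem //; case: (_ \in _); rewrite ?muln1 ?muln0.
  lia.
Qed.

(** The |F| rounds test 0, ..., |F| - 1 copies. The value |F| is only reached untested, and then
    [k = K], for which success is assumed. *)
Lemma capacityP K : success A vs F (copies K) -> K <= size F ->
  exists2 k, k <= K & capacity A vs F = copies k /\ success A vs F (copies k).
Proof.
move=> sK KF; rewrite /capacity.
set st := fun (C : seq V) (_ : V * V) => _.
have main (s : seq (V * V)) : exists2 k, k <= K & foldl st [::] s = copies k /\
    (success A vs F (copies k) \/ k = size s).
  elim/last_ind: s => [|s a [k kK [e h]]]; first by exists 0 => //; split=> //;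
    right.
  rewrite foldl_rcons e size_rcons /st; case: ifP => sk; first by exists k;
    auto.
  case: h => [|ks]; first by rewrite sk.
  exists k.+1; last by split=> //; right; rewrite ks.
  (* A failed test excludes [k = K]. *)
  by rewrite ltn_neqAle kK andbT; apply: contraFneq sk => ->.
have [k kK [e [|ks]]] := main F; exists k => //; split=> //.
by have -> : k = K by apply/eqP; rewrite eqn_leq kK ks KF.
Qed.

Lemma flowP K : success A vs F (copies K) -> K <= size F ->
  let E := flow A vs F in
  [/\ perm_eq (unzip1 E) (unzip2 E), {subset E <= A}
    & forall v, count_mem v (unzip2 E) <= K].
Proof.
move=> sK /(capacityP sK)[k kK [e sk]].
have [b EA le] := attempt_sound sk; rewrite /flow e; split=> // v.
exact: leq_trans kK.
Qed.

(** Connectivity is assumed in terms of predicates constant along the arcs of [F]. Membership in the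
    trail is such a predicate, so the trail visits every vertex. *)
Lemma circuit_of_trail K v0 : hall K -> K <= size F ->
  (forall v, count_mem v (unzip1 F) <= K) -> (forall v, count_mem v (unzip2 F)
    <= K) ->
  F != [::] -> {in F, forall a, a.1 != a.2} -> v0 \in vs ->
  (forall P : pred V, {in F, forall a, P a.1 = P a.2} -> P v0 -> {in vs, forall
    v, P v}) ->
  exists c, [/\ trail (flow A vs F) v0 = v0 :: c, c != [::],
    cycle (fun x y => (x, y) \in A) c, {subset c <= vs}
    & {in vs, forall v, 0 < count_mem v c <= K}].
Proof.
move=> hK KF d1 d2 F0 Fnl v0vs conn.
have [b EA le] := flowP (success_complete d1 d2 hK) KF.
have [c [tE pc lc lec cl]] := trailP v0 b; exists c.
have vis : {in vs, forall v, v \in v0 :: c}.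
  by apply: (conn (mem (v0 :: c))); [move=> a aF; apply: cl;
    rewrite mem_cat aF|apply: mem_head].
(* Otherwise [v0] would be the only vertex visited, but an arc of [F] has two distinct visited
   ends. *)
have c0 : c != [::].
  apply/eqP => cn; case: (F) F0 Fnl FA => // a F' _ nl sub;
    have aF := mem_head a F'.
  have /andP[/vis a1 /vis a2] := Avs (sub _ aF); move: (nl _ aF).
  by move: a1 a2; rewrite cn !inE => /eqP-> /eqP->; rewrite eqxx.
have cvs : {subset c <= vs}.
  move=> v; rewrite -has_pred1 has_count => vc; have := leq_trans vc (lec v).
  by rewrite -has_count has_pred1 => /mapP[a /EA/Avs/andP[_ a2] ->].
have v0c : v0 \in c.
  by case: (c) c0 lc => //= x c' _ <-; apply: mem_last.
split=> //.
  case/lastP: (c) c0 pc lc => // c' x _; rewrite last_rcons => pc e; subst x.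
  rewrite -rot1_cons rot_cycle /=; apply: sub_path pc => x y; exact: EA.
move=> v vvs; rewrite (leq_trans (lec v) (le v)) andbT -has_count has_pred1.
by have := vis v vvs; rewrite inE => /orP[/eqP->|].
Qed.
End Flow.

(** * Hall's condition from a thin tree *)

Import Order.TTheory GRing.Theory Num.Theory.
Local Open Scope ring_scope.

(** * Cuts of a Held-Karp solution *)

Section HeldKarp.
Variables (R : realDomainType) (W : finType) (A : {set W * W}).
Variable x : {ffun W * W -> R}.
Hypothesis hk : held_karp A x.

Lemma held_karp_ge0 a : 0 <= x a.
Proof. by case: hk => x0 _ _ xge0; have [/xge0|/x0 ->] := boolP (a \in A). Qed.

Lemma mem_cut U a : a \in A -> a.1 != a.2 ->
  ([set a.1; a.2] \in cut A U) = (a.1 \in U) (+) (a.2 \in U).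
Proof.
move=> aA nl; rewrite !inE.
have -> : [set a.1; a.2] \in edges A by apply/imsetP; exists a;
  rewrite ?inE ?aA.
rewrite andTb setIUl.
have I1 v : [set v] :&: U = if v \in U then [set v] else set0.
  by case: ifP => vU; apply/setP => w; rewrite !inE; case: eqP => // ->;
    rewrite vU.
rewrite !I1; case: (a.1 \in U); case: (a.2 \in U);
  rewrite ?set0U ?setU0 ?cards1 ?cards0 //.
by rewrite cards2 nl.
Qed.

Lemma zstar_cut U : vsum (zstar x) (cut A U) =
  vsum x (out_cut A U) + vsum x (in_cut A U).
Proof.
rewrite /vsum /zstar (exchange_big_dep xpredT) //=.
have -> : \sum_a \sum_(e in cut A U | [set a.1; a.2] == e) x a =
    \sum_a if [set a.1; a.2] \in cut A U then x a else 0.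
  apply: eq_bigr => a _; case: ifP => aU.
    by rewrite (big_pred1 [set a.1; a.2]) // => e /=;
      rewrite andbC [RHS]eq_sym; case: eqP => //= <-.
  by rewrite big1 // => e /andP[eU /eqP ae]; rewrite ae eU in aU.
rewrite [in RHS]big_mkcond [X in _ = _ + X]big_mkcond -big_split;
  apply: eq_bigr => a _ /=.
have [aA|aA] := boolP (a \in A); last first.
  by case: hk => x0 _ _ _; rewrite x0 // !inE !if_same addr0.
have [aa|nl] := eqVneq a.1 a.2.
  have -> : ([set a.1; a.2] \in cut A U) = false.
    apply/negbTE; rewrite inE negb_and; apply/orP; left.
    apply/imsetP => -[b]; rewrite inE aa setUid => /andP[_ nb] /setP e.
    by move: (e b.1) (e b.2); rewrite !inE !eqxx ?orbT => /eqP b1 /eqP b2;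
      rewrite b1 b2 eqxx in nb.
  by rewrite !inE aa; case: (a.2 \in U); rewrite ?andbF addr0.
rewrite mem_cut // !inE aA.
by case: (a.1 \in U); case: (a.2 \in U); rewrite ?addr0 ?add0r.
Qed.

(** Summing the two degree constraints over [U], the arcs inside [U] contribute the same amount
    [inner] to both sides. *)
Lemma out_in_cut U : vsum x (out_cut A U) = vsum x (in_cut A U).
Proof.
pose inner := \sum_(a in A | [&& a.1 != a.2, a.1 \in U & a.2 \in U]) x a.
have e1 : \sum_(v in U) vsum x (out_cut A [set v]) = vsum x (out_cut A U) +
  inner.
  rewrite /vsum (exchange_big_dep (fun a =>
    [&& a \in A, a.1 != a.2 & a.1 \in U])) /=; last first.
    by move=> v a vU; rewrite !inE => /and3P[-> /eqP-> ne];
      rewrite eq_sym ne vU.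
  rewrite (bigID (fun a => a.2 \in U)) /= addrC; congr (_ + _).
    apply: eq_big => [a|a /andP[/and3P[aA nl a1] a2]].
      rewrite !inE; case: (a \in A) => //=; case: eqP => [->|_] //=.
      by case: (_ \in U).
    rewrite (big_pred1 a.1) // => v; rewrite !inE aA /= [RHS]eq_sym.
    by case: (a.1 =P v) => [<-|]; rewrite ?andbF // a1 eq_sym nl.
  apply: eq_big => [a|a /andP[/and3P[aA nl a1] a2]]; first by rewrite -!andbA.
  rewrite (big_pred1 a.1) // => v; rewrite !inE aA /= [RHS]eq_sym.
  by case: (a.1 =P v) => [<-|]; rewrite ?andbF // a1 eq_sym nl.
have e2 : \sum_(v in U) vsum x (in_cut A [set v]) = vsum x (in_cut A U) + inner.
  rewrite /vsum (exchange_big_dep (fun a =>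
    [&& a \in A, a.1 != a.2 & a.2 \in U])) /=; last first.
    by move=> v a vU; rewrite !inE negbK => /and3P[-> ne /eqP->]; rewrite ne vU.
  rewrite (bigID (fun a => a.1 \in U)) /= addrC; congr (_ + _).
    apply: eq_big => [a|a /andP[/and3P[aA nl a1] a2]].
      rewrite !inE negbK; case: (a \in A) => //=; case: eqP => [->|_] //=.
        by case: (_ \in U).
      by rewrite andbC.
    rewrite (big_pred1 a.2) // => v; rewrite !inE aA negbK /= [RHS]eq_sym.
    by case: (a.2 =P v) => [<-|]; rewrite ?andbF // a1 nl.
  apply: eq_big => [a|a /andP[/and3P[aA nl a1] a2]].
    by rewrite -!andbA; case: (a.1 \in U); rewrite ?andbF ?andbT.
  rewrite (big_pred1 a.2) // => v; rewrite !inE aA negbK /= [RHS]eq_sym.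
  by case: (a.2 =P v) => [<-|]; rewrite ?andbF // a1 nl.
case: hk => _ deg _ _.
have : \sum_(v in U) vsum x (out_cut A [set v]) = \sum_(v in U) vsum x (in_cut
  A [set v]).
  by apply: eq_bigr => v _; case: (deg v) => -> ->.
by rewrite e1 e2 => /addIr.
Qed.

Definition out_neighbours (U : {set W}) :=
  [set w | w \notin U & [exists a in A, (a.1 \in U) && (a.2 == w)]].

(** Grouped by head, the arcs leaving [U] into [w] carry at most the total 1 that enters [w]. *)
Lemma out_cut_le (U : {set W}) :
  vsum x (out_cut A U) <= #|out_neighbours U|%:R.
Proof.
have -> : #|out_neighbours U|%:R = \sum_(w in out_neighbours U) vsum x (in_cut
  A [set w]).
  rewrite (eq_bigr (fun=> 1)) ?sumr_const // => w _.
  by case: hk => _ deg _ _; case: (deg w).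
rewrite /vsum (partition_big (fun a => a.2) (mem (out_neighbours U))) /=.
  apply: ler_sum => w wN; rewrite [leRHS]big_mkcond [leLHS]big_mkcond /=.
  apply: ler_sum => a _; rewrite !inE negbK.
  case: ifP => [/andP[/and3P[-> a1 a2] /eqP aw]|_]; last by case: ifP => // _;
    apply: held_karp_ge0.
  by rewrite aw eqxx; case: eqP => // a1w; rewrite a1w -aw (negPf a2) in a1.
move=> a; rewrite !inE => /and3P[aA a1 ->] /=.
by apply/existsP; exists a; rewrite aA a1 eqxx.
Qed.

(** On a single vertex the out-cut would be empty, against out-degree 1. *)
Lemma proper_set1 w : [set w] \proper [set: W].
Proof.
rewrite properE subsetT /=; apply/negP => /subsetP all.
case: hk => _ /(_ w)[+ _] _ _; rewrite /vsum big_pred0 => [/eqP|a].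
  by rewrite eq_sym oner_eq0.
by rewrite inE (all a.2 (in_setT _)) !andbF.
Qed.
End HeldKarp.

(** * Counting tree arcs across cuts *)

Section Thin.
Variables (R : archiRealFieldType) (W : finType) (V : eqType) (f : W -> V).
Variables (A : {set W * W}) (x : {ffun W * W -> R}) (T : {set {set W}}) (beta :
  R).
Hypothesis f_inj : injective f.
Hypothesis hk : held_karp A x.
Hypothesis thin : thin_tree A (zstar x) beta T.

Let f2 (a : W * W) := (f a.1, f a.2).
Let vs := [seq f w | w <- enum W].
Let As := [seq f2 a | a <- enum A].
Let Ts := [seq [seq f w | w <- enum e] | e : {set W} <- enum T].
Let F := orientation As Ts.

Lemma orient_edge (e : {set W}) : e \in T -> exists a,
  [/\ orient As [seq f w | w <- enum e] = [:: f2 a], a \in A, a.1 != a.2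
    & [set a.1; a.2] = e].
Proof.
case: thin => -[_ TE _ _] _ /(subsetP TE)/imsetP[b];
  rewrite inE => /andP[bA nb] eE.
rewrite /orient; case fE: filter => [|c s].
  have : f2 b \in [seq a <- As | (a.1 != a.2) && (a.1 \in [seq f w | w <- enum
    e]) &&
      (a.2 \in [seq f w | w <- enum e])].
    rewrite mem_filter (map_f f2) ?mem_enum // andbT /= (inj_eq f_inj) nb.
    by rewrite !(mem_map f_inj) !mem_enum eE !inE !eqxx orbT.
  by rewrite fE.
have := mem_head c s; rewrite -fE mem_filter => /andP[+ /mapP[a]].
rewrite mem_enum => + aA cE;
  rewrite cE /= (inj_eq f_inj) !(mem_map f_inj) !mem_enum.
move=> /andP[/andP[na a1] a2]; exists a; split=> //.
apply/eqP; rewrite eqEcard cards2 na; apply/andP; split.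
  by apply/subsetP => w; rewrite !inE => /orP[]/eqP->.
by rewrite eE cards2; case: (_ != _).
Qed.

(** Lifts [F] back along [f] to arcs [F0] over [W], one for each tree edge, where cuts are
    available. *)
Lemma orientationP : exists F0 : seq (W * W), [/\ F = map f2 F0, {subset F0 <=
  A},
  {in F0, forall a, a.1 != a.2} & [seq [set a.1; a.2] | a <- F0] = enum T].
Proof.
have : {subset enum T <= T} by move=> e; rewrite mem_enum.
rewrite /F /orientation /Ts; elim: (enum T) => [|e s IH] sub.
  by exists [::].
have [|F0 [FE F0A nl eE]] := IH; first by move=> e' es;
  rewrite sub // inE es orbT.
have [a [oE aA na ae]] := orient_edge (sub _ (mem_head _ _)).
exists (a :: F0); split.
- by rewrite /= oE FE.
- by move=> b; rewrite inE => /orP[/eqP->|/F0A].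
- by move=> b; rewrite inE => /orP[/eqP->|/nl].
- by rewrite /= ae eE.
Qed.

Variable F0 : seq (W * W).
Hypothesis F0A : {subset F0 <= A}.
Hypothesis F0_loopless : {in F0, forall a, a.1 != a.2}.
Hypothesis F0_edges : [seq [set a.1; a.2] | a <- F0] = enum T.

Lemma count_cut (U : {set W}) :
  count (fun a => (a.1 \in U) (+) (a.2 \in U)) F0 = #|T :&: cut A U|.
Proof.
have -> : count (fun a => (a.1 \in U) (+) (a.2 \in U)) F0 =
    count (mem (cut A U)) (enum T).
  rewrite -F0_edges count_map; apply: eq_in_count => a aF /=.
  by rewrite mem_cut ?F0A ?F0_loopless.
rewrite -sum1_count big_enum_cond /= -sum1_card.
by apply: eq_bigl => e; rewrite !inE.
Qed.

(** An arc with head in [U] has its tail in [U] or crosses the cut of [U]; an arc with head in [D]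
    crosses the cut of that head. *)
Lemma count_heads (U D : {set W}) :
  (count (fun a => a.2 \in U :|: D) F0 <= count (fun a => a.1 \in U) F0 +
    #|T :&: cut A U| + \sum_(w in D) #|T :&: cut A [set w]|)%N.
Proof.
have cE P : count P F0 = (\sum_(a <- F0) (P a : nat))%N.
  by rewrite -sum1_count big_mkcond; apply: eq_bigr => a _; case: (P a).
under eq_bigr do rewrite -count_cut cE.
rewrite -count_cut !cE.
rewrite exchange_big -!big_split /= big_seq [leqRHS]big_seq leq_sum // => a aF.
rewrite inE; have [a2|a2] := boolP (a.2 \in U); first by case: (a.1 \in U).
case: (boolP (a.2 \in D)) => //= aD; rewrite (bigD1 a.2) //= !inE eqxx.
by rewrite (negPf (F0_loopless aF)) /= addnCA leq_addr.
Qed.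

Lemma degree_le w : #|T :&: cut A [set w]|%:R <= 2 * beta.
Proof.
case: thin => _ /(_ [set w] (proper_set1 hk w)).
have [_ deg _ _] := hk; have [o i] := deg w.
by rewrite (zstar_cut hk) o i -[1 + 1]/2%:R mulrC.
Qed.

(** As much leaves [U] as enters it, so the value of the cut is twice that of the outgoing arcs:
    hence the 2. *)
Lemma cut_le (U : {set W}) : U \proper [set: W] ->
  #|T :&: cut A U|%:R <= 2 * beta * #|out_neighbours A U|%:R.
Proof.
move=> pU; case: thin => -[] /card_gt0P[w _] _ _ _ /(_ U pU) le.
have b0 : 0 <= beta by have := degree_le w;
  have := ler0n R #|T :&: cut A [set w]|; lra.
apply: le_trans le _; rewrite (zstar_cut hk) -(out_in_cut hk).
have := out_cut_le hk U; nra.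
Qed.

Lemma beta_ge0 : 0 <= beta.
Proof.
case: thin => -[] /card_gt0P[w _] _ _ _ _.
by have := degree_le w; have := ler0n R #|T :&: cut A [set w]|; lra.
Qed.

Lemma reachableE (S : pred V) w (U := [set w | S (f w)]) :
  reachable (As ++ [seq (v, v) | v <- vs]) S (f w) = (w \in U :|:
    out_neighbours A U).
Proof.
apply/hasP/setUP => [[a]|[]].
- rewrite mem_cat => /orP[/mapP[b]|/mapP[v _ ->]]; last first.
    by move=> /= /andP[Sv /eqP vw]; left; rewrite inE -vw.
  rewrite mem_enum => bA -> /= /andP[Sb /eqP/f_inj bw].
  have [wU|wU] := boolP (w \in U); [by left|right].
  by rewrite inE wU; apply/existsP; exists b; rewrite bA inE Sb bw eqxx.
- rewrite inE => Sw; exists (f w, f w); last by rewrite /= Sw eqxx.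
  by rewrite mem_cat; apply/orP; right; apply/map_f/map_f; rewrite mem_enum.
- rewrite inE => /andP[_ /existsP[b /and3P[bA Sb /eqP bw]]].
  exists (f2 b); last by rewrite /= bw eqxx andbT; rewrite inE in Sb.
  by rewrite mem_cat (map_f f2) ?mem_enum.
Qed.

Lemma count_vs (S : pred V) : count S vs = #|[set w | S (f w)]|.
Proof.
rewrite count_map -sum1_count big_enum_cond /= -sum1_card.
by apply: eq_bigl => w; rewrite inE.
Qed.

Lemma card_reachable (S : pred V) (U := [set w | S (f w)]) :
  count (reachable (As ++ [seq (v, v) | v <- vs]) S) vs =
  (#|U| + #|out_neighbours A U|)%N.
Proof.
rewrite count_vs.
have -> : [set w | reachable (As ++ [seq (v, v) | v <- vs]) S (f w)] =
    U :|: out_neighbours A U.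
  by apply/setP => w; rewrite inE reachableE.
rewrite cardsU (_ : _ :&: _ = set0) ?cards0 ?subn0 //.
by apply/setP => w; rewrite !inE; case: (S (f w)).
Qed.

(** The two improper cases are immediate: nothing is reachable from the empty set, and all arcs of
    [F0] have their tail in the full set. *)
Lemma hall_of_cuts (K : nat) :
  (forall U : {set W}, U != set0 -> U \proper [set: W] ->
    (count (fun a => a.2 \in U :|: out_neighbours A U) F0 <=
     count (fun a => a.1 \in U) F0 + K * #|out_neighbours A U|)%N) ->
  hall As vs (map f2 F0) K.
Proof.
move=> cuts S; set U := [set w | S (f w)].
rewrite card_reachable count_vs -/U /unzip1 /unzip2 !count_map.
rewrite (eq_count (a2 := fun a => a.2 \in U :|: out_neighbours A U));
  last first.
  by move=> a; apply: (reachableE S a.2).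
rewrite [X in (_ <= _ + X)%N](eq_count (a2 := fun a => a.1 \in U)); last first.
  by move=> a; rewrite /U inE.
have [U0|U0] := eqVneq U set0.
  rewrite [X in (_ + X <= _)%N](eq_count (a2 := pred0)) ?count_pred0;
    first by rewrite mulnDr; lia.
  move=> a; rewrite U0 !inE /=; apply/negbTE/existsP => -[b].
  by rewrite inE andbF.
have [pU|pU] := boolP (U \proper [set: W]); first by have := cuts U U0 pU;
  rewrite mulnDr; lia.
have UT : U = [set: W].
  by apply/eqP; rewrite properE subsetT negbK in pU; rewrite -subTset.
rewrite [X in (_ <= _ + X)%N](eq_count (a2 := predT)) ?count_predT; last first.
  by move=> a; rewrite UT inE.
by rewrite mulnDr; have := count_size (fun a =>
  a.2 \in U :|: out_neighbours A U) F0; lia.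
Qed.

Lemma hall_thin (K : nat) : 4 * beta <= K%:R -> hall As vs (map f2 F0) K.
Proof.
move=> bK; apply: hall_of_cuts => U _ pU.
apply: leq_trans (count_heads U (out_neighbours A U)) _.
rewrite -addnA leq_add2l -(ler_nat R) natrD natrM natr_sum.
have := cut_le pU.
have : \sum_(w in out_neighbours A U) (#|T :&: cut A [set w]|%:R : R) <=
    2 * beta * #|out_neighbours A U|%:R.
  rewrite mulr_natr -(sumr_const (mem (out_neighbours A U))).
  by apply: ler_sum => w _; apply: degree_le.
have := ler0n R #|out_neighbours A U|; nra.
Qed.

(** The cut constraint yields an out-neighbour, and one out-neighbour brings |F| units of capacity,
    enough for all arcs of [F0]. *)
Lemma hall_size : hall As vs (map f2 F0) (size F0).
Proof.
apply: hall_of_cuts => U U0 pU.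
have [_ _ conn _] := hk; have := le_trans (conn U U0 pU) (out_cut_le hk U).
rewrite (ler_nat R 1) => D1.
apply: leq_trans (count_size _ _) _; rewrite (leq_trans _ (leq_addl _ _)) //.
by rewrite -{1}[size F0]muln1 leq_mul2l D1 orbT.
Qed.

(** The arcs of [F0] with tail (or head) [v] are tree edges at [v], at most 2 beta of them. The
    boolean treats tails and heads together. *)
Lemma degree_thin (K : nat) (i : bool) v : 4 * beta <= K%:R ->
  (count_mem v [seq if i then a.1 else a.2 | a <- map f2 F0] <= K)%N.
Proof.
move=> bK; rewrite -map_comp count_map.
have [|] := boolP (has (fun a => (if i then f a.1 else f a.2) == v) F0);
  last first.
  rewrite has_count -leqNgt leqn0 => /eqP c0;
    rewrite (leq_trans _ (leq0n K)) //.
  by rewrite -c0; apply: sub_count => a /=; case: (i).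
case/hasP => b bF /eqP bv; pose w := if i then b.1 else b.2.
have vE : v = f w by rewrite -bv /w; case: (i).
have := degree_le w; rewrite -count_cut => le.
apply: (@leq_trans (count (fun a =>
  (a.1 \in [set w]) (+) (a.2 \in [set w])) F0)).
  apply: sub_in_count => a aF /=; rewrite vE !inE.
  case: (i) => /eqP/f_inj e; have := F0_loopless aF; rewrite -e.
    by rewrite eqxx eq_sym => /negPf ->.
  by rewrite eqxx => /negPf ->.
by rewrite -(ler_nat R); apply: le_trans le _; have := beta_ge0; lra.
Qed.

(** A predicate constant along the arcs of [F0] is closed under adjacency in [T], which connects all
    vertices. *)
Lemma connected_F0 (P : pred V) : {in map f2 F0, forall a, P a.1 = P a.2} ->
  {in vs &, forall u v, P u = P v}.
Proof.
move=> PF _ _ /mapP[u _ ->] /mapP[v _ ->].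
case: thin => -[_ _ conn _] _.
have cl : closed (adj T) [pred w | P (f w)].
  move=> a b; rewrite /adj -mem_enum -F0_edges => /mapP[c cF e].
  have := PF _ (map_f f2 cF); rewrite /= !inE => Pc.
  have : a \in [set c.1; c.2] by rewrite -e set21.
  have : b \in [set c.1; c.2] by rewrite -e set22.
  by rewrite !inE => /orP[]/eqP-> /orP[]/eqP->.
exact: (closed_connect cl (conn u v)).
Qed.

End Thin.

(** * Correctness of the output and the encoded instance *)

Lemma subset_map (W V : eqType) (f : W -> V) (s : seq W) (c : seq V) :
  {subset c <= map f s} -> exists c', c = map f c'.
Proof.
elim: c => [|v c IH] sub; first by exists [::].
have [|c' ->] := IH; first by move=> w wc; rewrite sub // inE wc orbT.
by have /mapP[w _ ->] := sub v (mem_head _ _); exists (w :: c').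
Qed.

(** [f] names the vertices: the identity for the existence statement, the injection of ordinals into
    numbers for the computation. *)
Theorem solveP (R : archiRealFieldType) (W : finType) (V : eqType) (f : W -> V)
    (A : {set W * W}) (x : {ffun W * W -> R}) (T : {set {set W}}) (beta : R) :
  injective f -> held_karp A x -> thin_tree A (zstar x) beta T ->
  exists2 c : seq W, circuit_visiting A (Num.ceil (4 * beta)) c &
    solve [seq f w | w <- enum W] [seq (f a.1, f a.2) | a <- enum A]
      [seq [seq f w | w <- enum e] | e : {set W} <- enum T] = map f c.
Proof.
move=> f_inj hk thin; set vs := map f _; set As := map _ (enum A).
have [F0 [FE F0A nl eE]] := orientationP f_inj thin.
have b0 : 0 <= 4 * beta by rewrite mulr_ge0 ?(beta_ge0 hk thin).
have ceil_b := ceil_ge (4 * beta).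
have ceil0 : 0 <= Num.ceil (4 * beta)
  by rewrite ceil_ge0 (lt_le_trans _ b0) // ltrN10.
have ceilE : (`|Num.ceil (4 * beta)|%N : int) = Num.ceil (4 * beta)
  by rewrite gez0_abs.
have bK : 4 * beta <= `|Num.ceil (4 * beta)|%N%:R by move: ceil_b;
  rewrite -{1}ceilE.
set K0 := `|_|%N in bK ceilE.
pose F := orientation As [seq [seq f w | w <- enum e] | e : {set W} <- enum T].
(* The search stops at |F|, so Hall's condition is wanted at a value exceeding neither |F| nor the
   ceiling. It holds at both, hence at the smaller one. *)
pose K := minn K0 (size F).
have sF : size F = size F0 by rewrite /F FE size_map.
have hK : hall As vs F K.
  rewrite /F FE /K sF; rewrite /minn; case: ifP => _;
    first exact: (hall_thin f_inj hk thin).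
  exact: (hall_size f_inj hk).
have d (i : bool) v : (count_mem v [seq if i then a.1 else a.2 | a <- F] <=
  K)%N.
  rewrite /K leq_min /F FE (degree_thin f_inj hk thin) //=.
  by rewrite (leq_trans (count_size _ _)) // size_map.
have Avs a : a \in As -> (a.1 \in vs) && (a.2 \in vs).
  by case/mapP => b _ -> /=; rewrite !map_f ?mem_enum.
have FA : {subset F <= As}.
  by rewrite /F FE => _ /mapP[a /F0A aA ->]; apply: map_f; rewrite mem_enum.
have vs_uniq : uniq vs by rewrite map_inj_uniq ?enum_uniq.
have conn := connected_F0 (f := f) thin eE.
case: (thin) => -[] /card_gt0P[w0 _] _ _ _ _.
have Fnl : {in F, forall a, a.1 != a.2}.
  by rewrite /F FE => _ /mapP[a /nl aF ->]; rewrite /= (inj_eq f_inj).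
have w0vs : f w0 \in vs by rewrite map_f ?mem_enum.
(* Without arcs every predicate would be constant on [vs], but there are two distinct vertices. *)
have F_nil : F != [::].
  apply/eqP => FN; have /properP[_ [w _ w_out]] := proper_set1 hk w0.
  have wvs : f w \in vs by rewrite map_f ?mem_enum.
  have PF : {in [seq (f a.1, f a.2) | a <- F0],
      forall a, pred1 (f w0) a.1 = pred1 (f w0) a.2} by rewrite -FE -/F FN.
  have := conn _ PF _ _ w0vs wvs; rewrite /= eqxx (inj_eq f_inj) => /esym ww.
  by rewrite inE ww in w_out.
have vsE : exists v s, vs = v :: s by case: (vs) w0vs => // v s; exists v, s.
have [v [s ve]] := vsE; have vvs : v \in vs by rewrite ve mem_head.
have [|c [tE c0 cyc csub cnt]] :=
  circuit_of_trail Avs FA vs_uniq hK (geq_minr _ _) (d true) (d false) F_nil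
    Fnl vvs.
  move=> P PF Pv u uvs; rewrite -(conn P _ v u) //.
  by rewrite -FE.
have [c' cE] := subset_map csub; exists c'.
  split.
    split; first by move=> c'0; rewrite cE c'0 in c0.
    move: cyc; rewrite cE cycle_map; apply: sub_cycle => a b /=.
    by case/mapP => -[a' b']; rewrite mem_enum => abA [/f_inj -> /f_inj ->].
  move=> w; have wvs : f w \in vs by rewrite map_f ?mem_enum.
  have := cnt _ wvs; rewrite cE count_map.
  rewrite (eq_count (a2 := pred1 w)) => [/andP[-> le]|a];
    last by rewrite /= (inj_eq f_inj).
  by split=> //; rewrite -ceilE lez_nat (leq_trans le) // geq_minl.
by rewrite /solve ve -/F -ve tE.
Qed.

Lemma enc_seq_map (X Y : Type) (e : Y -> data) (g : X -> Y) (s : seq X) :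
  enc_seq e (map g s) = enc_seq (fun x => e (g x)) s.
Proof. by elim: s => //= x s ->. Qed.

(** The instance over numbers instead of ordinals, whose type depends on [n]: a program works for
    all [n] at once. Rational data stay in encoded form. *)
Definition raw_instance (n : nat) (A : {set 'I_n * 'I_n})
    (x : {ffun 'I_n * 'I_n -> rat}) (T : {set {set 'I_n}}) (beta : rat) :
    seq nat * (seq (nat * nat * data) * (seq (seq nat) * data)) :=
  ([seq val v | v <- enum 'I_n],
   ([seq ((val a.1, val a.2), enc_rat (x a)) | a <- enum A],
    ([seq [seq val v | v <- enum e] | e : {set 'I_n} <- enum T],
     enc_rat beta))).

Lemma enc_raw_instance (n : nat) (A : {set 'I_n * 'I_n})
    (x : {ffun 'I_n * 'I_n -> rat}) (T : {set {set 'I_n}}) (beta : rat) :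
  enc (raw_instance A x T beta) = enc_instance A x T beta.
Proof.
rewrite /enc_instance /enc_vertices /= !enc_seq_map;
  congr (Node _ (Node _ (Node _ _))).
by elim: (enum T) => //= e s ->; rewrite enc_seq_map.
Qed.

Theorem lemma4 :
  (* existence, for arbitrary (real) data *)
  (forall (R : archiRealFieldType) (V : finType) (A : {set V * V})
      (x : {ffun V * V -> R}) (T : {set {set V}}) (beta : R),
    held_karp A x ->
    supported_thin_tree A (zstar x) beta T ->
    exists c : seq V, circuit_visiting A (Num.ceil (4 * beta)) c)
  /\
  (* a polynomial-time algorithm, for rational data *)
  (exists (p : cmd) (a k : nat),
    forall (n : nat) (A : {set 'I_n * 'I_n}) (x : {ffun 'I_n * 'I_n -> rat})
      (T : {set {set 'I_n}}) (beta : rat),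
    held_karp A x ->
    supported_thin_tree A (zstar x) beta T ->
    exists c : seq 'I_n,
      circuit_visiting A (Num.ceil (4 * beta)) c /\
      computes_within p (enc_instance A x T beta) (enc_vertices c)
        (a * dsize (enc_instance A x T beta) ^ k)%N).
Proof.
split=> [R V A x T beta hk [thin _]|].
  by have [c cP _] := solveP (f := id) (fun _ _ => id) hk thin; exists c.
pose X := prod_encT (seq_encT nat_encT)
  (prod_encT (seq_encT (prod_encT (prod_encT nat_encT nat_encT) data_encT))
    (prod_encT (seq_encT (seq_encT nat_encT)) data_encT)).
have [p [m [h [[a [k hE]] cp]]]] : ptime (fun i : X =>
    solve i.1 [seq b.1 | b <- i.2.1] i.2.2.1) by apply: ptime_solve;
      solve_ptime.
exists p, a, k => n A x T beta hk [thin _].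
have [c cP cE] := solveP val_inj hk thin; exists c; split=> //.
have eI := enc_raw_instance A x T beta.
have [s [t [e [s0 _ le]]]] := cp (raw_instance A x T beta)
  (update (fun=> Leaf) 0 (enc_instance A x T beta)) (esym eI).
exists s, t; split=> //.
  by rewrite s0 -map_comp -[map _ (enum A)]/(map _ _) cE /enc_vertices /=
    enc_seq_map.
by rewrite -eI; apply: leq_trans le (hE _).
Qed.
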